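(* Let $G=(V,E)$ be an undirected bipartite graph, whose edges may be weighted, with maximum degree $\Delta$. For a starting vertex $v$ and a target size $K$, the algorithm LocalDensity$(v,K)$ (defined in the context) runs in time $O(\Delta K^2)$.
   Context: Logarithms are base 2. $\|\cdot\|$ is the Euclidean norm, $\langle\cdot,\cdot\rangle$ the standard inner product, and vectors are row vectors indexed by $V$. $A$ is the adjacency matrix of $G$; if the edges are weighted, $A_{u,v}$ is the weight of the edge $\{u,v\}$. For sets of vertices $S,T$ on opposite sides of the bipartition, $(S,T)$ denotes the induced bipartite subgraph on $S\cup T$, $e(S,T)=\langle 1_SA,1_T\rangle$ is the sum of the weights of the edges between $S$ and $T$ (where $1_S$ is the indicator vector of $S$), and the density is $d(S,T)=\frac{e(S,T)}{\sqrt{|S|}\sqrt{|T|}}$. For a vector $z$, $\mathrm{round}(z)$ is obtained by rounding each nonzero entry up to the nearest power of 2, that is, replacing $z(u)$ by $2^i$ where $i$ is the smallest integer with $2^i\ge z(u)$; zero entries stay zero. For $\epsilon\ge0$, $\mathrm{prune}_\epsilon(z)$ is obtained from $z$ by setting to zero every entry with $z(u)\le\epsilon\|z\|$ and leaving the other entries unchanged. Pruned growth process: given a starting vector $x_0$ with entries in $\{0,1\}$ and real numbers $\epsilon_t\in[0,1]$, define $x_{t+1}=\mathrm{prune}_{\epsilon_{t+1}}(\mathrm{round}(x_tA))$. Let $X^t_i$ be the set of vertices $v$ with $x_t(v)=2^i$, and $Y^t_i$ the set of vertices $v$ with $\mathrm{round}(x_tA)(v)=2^i$. Algorithm LocalDensity$(v,K)$: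 let $x_0=1_{\{v\}}$, $\tau=\lceil\log\sqrt{2K}\rceil$, and $\epsilon_t=\frac{2^{t}}{8K}$. Compute the vectors $x_0,\dots,x_\tau$ of the pruned growth process. Compute $d(X^t_i,Y^t_j)$ for each pair $i,j$ (with both sets nonempty) and each time $t<\tau$. Output the subgraph $(X^t_i,Y^t_j)$ with the highest density. *)

(* Defs.v *)
From mathcomp Require Import all_boot all_order all_algebra.
From mathcomp Require Import boolp classical_sets reals exp.

Set Implicit Arguments.
Unset Strict Implicit.
Unset Printing Implicit Defensive.

Import Order.TTheory GRing.Theory Num.Theory.

Local Open Scope ring_scope.

(* A graph on V = 'I_n is given by its (weighted) adjacency matrix.  Edge     *)
(* weights are positive, so {u, v} is an edge iff 0 < A u v; unweighted       *)
(* graphs are the matrices with entries in {0, 1}.                            *)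
Definition bipartite_graph (R : realType) (n : nat) (A : 'M[R]_n) : Prop :=
  [/\ A^T = A,
      forall u v, 0 <= A u v &
      exists L : {set 'I_n}, forall u v, 0 < A u v -> (u \in L) != (v \in L)].

Definition nbrs (R : realType) (n : nat) (A : 'M[R]_n) (u : 'I_n) :
  {set 'I_n} := [set w | 0 < A u w].

Definition max_degree (R : realType) (n : nat) (A : 'M[R]_n) : nat :=
  (\max_(u < n) #|nbrs A u|)%N.

Definition ind (R : realType) (n : nat) (S : {set 'I_n}) : 'rV[R]_n :=
  \row_u (u \in S)%:R.

Definition inner (R : realType) (n : nat) (x y : 'rV[R]_n) : R :=
  \sum_u x 0 u * y 0 u.

Definition norm (R : realType) (n : nat) (x : 'rV[R]_n) : R :=
  Num.sqrt (inner x x).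

Definition edge_weight (R : realType) (n : nat) (A : 'M[R]_n)
    (S T : {set 'I_n}) : R :=
  inner (ind R S *m A) (ind R T).

Definition density (R : realType) (n : nat) (A : 'M[R]_n)
    (S T : {set 'I_n}) : R :=
  edge_weight A S T / (Num.sqrt #|S|%:R * Num.sqrt #|T|%:R).

Definition log2 (R : realType) (r : R) : R := ln r / ln 2.

(* The smallest integer i with r <= 2 ^ i; it exists iff 0 < r, and the value *)
(* is irrelevant otherwise.                                                   *)
Definition up_exp (R : realType) (r : R) : int :=
  xget 0 [set i : int | r <= 2 ^ i /\ forall j : int, r <= 2 ^ j -> i <= j].

Definition round (R : realType) (n : nat) (z : 'rV[R]_n) : 'rV[R]_n :=
  \row_u if z 0 u == 0 then 0 else 2 ^ up_exp (z 0 u).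

Definition prune (R : realType) (n : nat) (eps : R) (z : 'rV[R]_n) :
    'rV[R]_n :=
  \row_u if z 0 u <= eps * norm z then 0 else z 0 u.

Fixpoint growth (R : realType) (n : nat) (A : 'M[R]_n) (eps : nat -> R)
    (x0 : 'rV[R]_n) (t : nat) : 'rV[R]_n :=
  if t is t'.+1 then prune (eps t) (round (growth A eps x0 t' *m A)) else x0.

Definition level (R : realType) (n : nat) (z : 'rV[R]_n) (i : int) :
    {set 'I_n} :=
  [set v | z 0 v == 2 ^ i].

Definition ld_tau (R : realType) (K : nat) : nat :=
  `|Num.ceil (log2 (Num.sqrt (2 * K%:R) : R))|%N.

Definition ld_eps (R : realType) (K t : nat) : R := 2 ^+ t / (8 * K%:R).

Definition ld_x (R : realType) (n : nat) (A : 'M[R]_n) (v : 'I_n) (K : nat) :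
    nat -> 'rV[R]_n :=
  growth A (ld_eps R K) (ind R [set v]).

Definition ld_X (R : realType) (n : nat) (A : 'M[R]_n) (v : 'I_n) (K t : nat)
    (i : int) : {set 'I_n} :=
  level (ld_x A v K t) i.

Definition ld_Y (R : realType) (n : nat) (A : 'M[R]_n) (v : 'I_n) (K t : nat)
    (j : int) : {set 'I_n} :=
  level (round (ld_x A v K t *m A)) j.

Definition ld_candidate (R : realType) (n : nat) (A : 'M[R]_n) (v : 'I_n)
    (K : nat) (S T : {set 'I_n}) : Prop :=
  exists (t : nat) (i j : int),
    [/\ (t < ld_tau R K)%N, S = ld_X A v K t i, T = ld_Y A v K t j,
        S != finset.set0 & T != finset.set0].

(* If v is isolated there is no candidate pair and the output is the empty    *)
(* graph.                                                                     *)
Definition ld_output (R : realType) (n : nat) (A : 'M[R]_n) (v : 'I_n)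
    (K : nat) (S T : {set 'I_n}) : Prop :=
  (ld_candidate A v K S T /\
   forall S' T', ld_candidate A v K S' T' -> density A S' T' <= density A S T)
  \/ ((forall S' T', ~ ld_candidate A v K S' T') /\ S = finset.set0 /\ T = finset.set0).

(* A real RAM with two kinds of cells, integers and exact reals.  Memory      *)
(* consists of zero-initialised random access arrays indexed by triples of    *)
(* integers; scalars are cells of index (0, 0, 0).  The graph is accessed     *)
(* only through its adjacency lists, one entry at a time.  Every node of an   *)
(* evaluated expression, every executed command and every loop iteration      *)
(* costs one unit of time; in particular arithmetic, square root, powers of 2 *)
(* and rounding up to a power of 2 have unit cost.                            *)

Inductive kind : Type := Int | Real.

Definition value (R : realType) (s : kind) : Type :=
  match s with Int => int | Real => R end.

Inductive var (s : kind) : Type := Var of nat.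

Inductive term : kind -> Type :=
| Cst    : int -> term Int
| Get    : forall s, var s -> term Int -> term Int -> term Int -> term s
| Succ   : term Int -> term Int
| ToReal : term Int -> term Real
| Add    : term Real -> term Real -> term Real
| Mul    : term Real -> term Real -> term Real
| Div    : term Real -> term Real -> term Real
| Sqrt   : term Real -> term Real
| Pow2   : term Int -> term Real
| UpExp  : term Real -> term Int
| Deg    : term Int -> term Int
| Nbr    : term Int -> term Int -> term Int
| Wt     : term Int -> term Int -> term Real.

Inductive cmd : Type :=
| Skip
| Assign  : forall s, var s -> term Int -> term Int -> term Int -> term s -> cmd
| Seq   : cmd -> cmd -> cmd
| IfLt  : term Real -> term Real -> cmd -> cmd -> cmd
| IfEq  : term Real -> term Real -> cmd -> cmd -> cmd
| For   : var Int -> term Int -> cmd -> cmd.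

Definition key : Type := (int * int * int)%type.

Record mem (R : realType) : Type :=
  Mem { imem : nat -> key -> int; rmem : nat -> key -> R }.

Definition mem0 (R : realType) : mem R := Mem (fun _ _ => 0) (fun _ _ => 0).

Definition read (R : realType) (m : mem R) (s : kind) (x : var s) (k : key) :
    value R s :=
  let: Var a := x in
  match s return value R s with Int => imem m a k | Real => rmem m a k end.

Definition upd (T : Type) (f : nat -> key -> T) (a : nat) (k : key) (w : T) :
    nat -> key -> T :=
  fun b l => if (b == a) && (l == k) then w else f b l.

Definition write (R : realType) (m : mem R) (s : kind) (x : var s) (k : key) :
    value R s -> mem R :=
  let: Var a := x in
  match s return value R s -> mem R with
  | Int => fun w => Mem (upd (imem m) a k w) (rmem m)
  | Real => fun w => Mem (imem m) (upd (rmem m) a k w)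
  end.

(* A vertex is represented by the integer (u : nat)%:Z. *)
Definition code (n : nat) (u : 'I_n) : int := (u : nat)%:Z.

Definition decode (n : nat) (z : int) : option 'I_n :=
  if z is Posz k then insub k else None.

Definition adj (R : realType) (n : nat) (A : 'M[R]_n) (z : int) :
    seq (int * R) :=
  if decode n z is Some u then [seq (code w, A u w) | w <- enum (nbrs A u)]
  else [::].

Fixpoint eval (R : realType) (n : nat) (A : 'M[R]_n) (m : mem R) (s : kind)
    (e : term s) : value R s :=
  match e in term s return value R s with
  | Cst c => c
  | Get _ x i j k => read m x (eval A m i, eval A m j, eval A m k)
  | Succ a => (eval A m a : int) + 1
  | ToReal a => (eval A m a : int)%:~R
  | Add a b => (eval A m a : R) + eval A m b
  | Mul a b => (eval A m a : R) * eval A m b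
  | Div a b => (eval A m a : R) / eval A m b
  | Sqrt a => Num.sqrt (eval A m a : R)
  | Pow2 a => 2 ^ (eval A m a : int)
  | UpExp a => up_exp (eval A m a : R)
  | Deg a => (size (adj A (eval A m a)))%:Z
  | Nbr a b => (nth (0, 0) (adj A (eval A m a)) `|(eval A m b : int)|%N).1
  | Wt a b => (nth (0, 0) (adj A (eval A m a)) `|(eval A m b : int)|%N).2
  end.

Fixpoint cost (s : kind) (e : term s) : nat :=
  match e with
  | Cst _ => 1
  | Get _ _ i j k => (cost i + cost j + cost k).+1
  | Succ a => (cost a).+1
  | ToReal a => (cost a).+1
  | Add a b => (cost a + cost b).+1
  | Mul a b => (cost a + cost b).+1
  | Div a b => (cost a + cost b).+1
  | Sqrt a => (cost a).+1
  | Pow2 a => (cost a).+1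
  | UpExp a => (cost a).+1
  | Deg a => (cost a).+1
  | Nbr a b => (cost a + cost b).+1
  | Wt a b => (cost a + cost b).+1
  end%N.

(* Final memory and running time.  For x e c evaluates the bound e once and   *)
(* runs c with x = 0, 1, ..., e - 1 (not at all if e is negative).            *)
Fixpoint exec (R : realType) (n : nat) (A : 'M[R]_n) (c : cmd) (m : mem R) :
    mem R * nat :=
  match c with
  | Skip => (m, 1%N)
  | Assign _ x i j k e =>
      (write m x (eval A m i, eval A m j, eval A m k) (eval A m e),
       (cost i + cost j + cost k + cost e).+1)
  | Seq c1 c2 =>
      let: (m1, t1) := exec A c1 m in
      let: (m2, t2) := exec A c2 m1 in (m2, (t1 + t2).+1)
  | IfLt a b c1 c2 =>
      let: (m', t) :=
        if (eval A m a : R) < eval A m b then exec A c1 m else exec A c2 m in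
      (m', (cost a + cost b + t).+1)
  | IfEq a b c1 c2 =>
      let: (m', t) :=
        if (eval A m a : R) == eval A m b then exec A c1 m else exec A c2 m in
      (m', (cost a + cost b + t).+1)
  | For x e c1 =>
      let N := if (eval A m e : int) is Posz N then N else 0%N in
      foldl (fun (st : mem R * nat) (l : nat) =>
               let: (m', t) := exec A c1 (write st.1 x (0, 0, 0) l%:Z) in
               (m', (st.2 + t).+1))
            (m, (cost e).+1) (iota 0 N)
  end.

(* Missing indices are 0. *)
Definition load (s : kind) (x : var s) (ks : seq (term Int)) : term s :=
  Get x (nth (Cst 0) ks 0) (nth (Cst 0) ks 1) (nth (Cst 0) ks 2).

Definition store (s : kind) (x : var s) (ks : seq (term Int)) (e : term s) :
    cmd :=
  Assign x (nth (Cst 0) ks 0) (nth (Cst 0) ks 1) (nth (Cst 0) ks 2) e.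

Definition scalar (s : kind) (x : var s) : term s := load x [::].
Coercion scalar : var >-> term.


Declare Scope prog_scope.
Delimit Scope prog_scope with P.
Arguments load {s} x ks%_P.
Arguments store {s} x ks%_P e%_P.
Coercion load : var >-> Funclass.
Notation "c1 ;; c2" := (Seq c1 c2)
  (at level 90, right associativity) : prog_scope.
Notation "x <-- e" := (store x [::] e) (at level 85) : prog_scope.
(* Forces elements of index lists to be terms, so that variables get coerced. *)
Notation "[ :: x1 ]" := (@cons (term Int) x1 nil) : prog_scope.
Notation "[ :: x1 ; x2 ; .. ; xn ]" :=
  (@cons (term Int) x1 (@cons (term Int) x2 .. (@cons (term Int) xn nil) ..))
  : prog_scope.
Notation "a + b" := (Add a b) : prog_scope.
Notation "a * b" := (Mul a b) : prog_scope.
Notation "a / b" := (Div a b) : prog_scope.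

Module LD.

Definition source : var Int := Var _ 0.
Definition target : var Int := Var _ 1.

(* The output is a pair of lists of vertices, out_S[0 .. out_nS - 1] and      *)
(* out_T[0 .. out_nT - 1].                                                    *)
Definition out_S : var Int := Var _ 2.
Definition out_nS : var Int := Var _ 3.
Definition out_T : var Int := Var _ 4.
Definition out_nT : var Int := Var _ 5.

(* x[t, u] = x_t(u), with support xs[t, 0 .. xn[t] - 1].                      *)
Definition x : var Real := Var _ 0.
Definition xs : var Int := Var _ 6.
Definition xn : var Int := Var _ 7.

(* z[t, u] = (x_t A)(u), with support ys[t, 0 .. yn[t] - 1], and              *)
(* ysq[t] = ||round(x_t A)|| ^ 2.                                             *)
Definition z : var Real := Var _ 1.
Definition ysq : var Real := Var _ 2.
Definition ys : var Int := Var _ 8.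
Definition yn : var Int := Var _ 9.

(* X^t_i is listed by Xs[t, i, 0 .. Xn[t, i] - 1], and Y^t_j likewise.        *)
Definition Xs : var Int := Var _ 10.
Definition Xn : var Int := Var _ 11.
Definition Ys : var Int := Var _ 12.
Definition Yn : var Int := Var _ 13.

(* e[t, i, j] = e(X^t_i, Y^t_j) and d[t, i, j] = d(X^t_i, Y^t_j).             *)
Definition e : var Real := Var _ 3.
Definition d : var Real := Var _ 4.

Definition best : var Real := Var _ 5.
Definition best_t : var Int := Var _ 14.
Definition best_i : var Int := Var _ 15.
Definition best_j : var Int := Var _ 16.

Definition tau : var Int := Var _ 17.
Definition t : var Int := Var _ 18.
Definition a : var Int := Var _ 19.
Definition b : var Int := Var _ 20.
Definition u : var Int := Var _ 21.
Definition w : var Int := Var _ 22.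
Definition i : var Int := Var _ 23.
Definition j : var Int := Var _ 24.

Definition real (c : int) : term Real := ToReal (Cst c).

Definition push (l len : var Int) (ks : seq (term Int)) (v : term Int) : cmd :=
  (store l (rcons ks (len ks)) v ;; store len ks (Succ (len ks)))%P.
Arguments push l len ks%_P v%_P.

Definition start : cmd := (
  tau <-- UpExp (Sqrt (real 2 * ToReal target)) ;;
  push xs xn [:: Cst 0] source ;;
  store x [:: Cst 0; source] (real 1)
)%P.

(* z = x_t A, together with the sets X^t_i. *)
Definition spread : cmd := (
  For a (xn [:: t]) (
    u <-- xs [:: t; a] ;;
    i <-- UpExp (x [:: t; u]) ;;
    push Xs Xn [:: t; i] u ;;
    For b (Deg u) (
      w <-- Nbr u b ;;
      IfEq (z [:: t; w]) (real 0) (push ys yn [:: t] w) Skip ;;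
      store z [:: t; w] (z [:: t; w] + x [:: t; u] * Wt u b)))
)%P.

(* Norm of round(x_t A), together with the sets Y^t_j. *)
Definition rounding : cmd := (
  For b (yn [:: t]) (
    w <-- ys [:: t; b] ;;
    j <-- UpExp (z [:: t; w]) ;;
    push Ys Yn [:: t; j] w ;;
    store ysq [:: t] (ysq [:: t] + Pow2 j * Pow2 j))
)%P.

(* x_{t+1}; the threshold is eps_{t+1} * ||round(x_t A)||. *)
Definition pruning : cmd := (
  For b (yn [:: t]) (
    w <-- ys [:: t; b] ;;
    j <-- UpExp (z [:: t; w]) ;;
    IfLt (Pow2 (Succ t) / (real 8 * ToReal target) * Sqrt (ysq [:: t])) (Pow2 j)
      (push xs xn [:: Succ t] w ;; store x [:: Succ t; w] (Pow2 j))
      Skip)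
)%P.

(* Runs c once for every edge {u, w} with x_t(u) <> 0, u in X^t_i and         *)
(* w in Y^t_j.                                                                *)
Definition for_edges (c : cmd) : cmd := (
  For a (xn [:: t]) (
    u <-- xs [:: t; a] ;;
    i <-- UpExp (x [:: t; u]) ;;
    For b (Deg u) (
      w <-- Nbr u b ;;
      j <-- UpExp (z [:: t; w]) ;;
      c))
)%P.

(* Pairs (X^t_i, Y^t_j) spanning no edge are not visited: their density is 0, *)
(* which is the initial value of d[t, i, j].  In a weighted graph there may   *)
(* be more than Delta * K ^ 2 of these.                                       *)
Definition densities : cmd := (
  for_edges (store e [:: t; i; j] (e [:: t; i; j] + Wt u b)) ;;
  for_edges (
    store d [:: t; i; j] (e [:: t; i; j] /
      (Sqrt (ToReal (Xn [:: t; i])) * Sqrt (ToReal (Yn [:: t; j])))) ;;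
    IfLt best (d [:: t; i; j])
      (best <-- d [:: t; i; j] ;;
       best_t <-- t ;; best_i <-- i ;; best_j <-- j)
      Skip)
)%P.

Definition output : cmd := (
  IfLt (real 0) best (
    For a (Xn [:: best_t; best_i])
      (push out_S out_nS [::] (Xs [:: best_t; best_i; a])) ;;
    For a (Yn [:: best_t; best_j])
      (push out_T out_nT [::] (Ys [:: best_t; best_j; a])))
  Skip
)%P.

End LD.

Definition LocalDensity : cmd := (
  LD.start ;;
  For LD.t LD.tau (
    LD.spread ;; LD.rounding ;; LD.pruning ;; LD.densities) ;;
  LD.output
)%P.

Definition ld_input (R : realType) (n : nat) (v : 'I_n) (K : nat) : mem R :=
  write (write (mem0 R) LD.source (0, 0, 0) (code v))
        LD.target (0, 0, 0) K%:Z.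

Definition ld_final (R : realType) (n : nat) (A : 'M[R]_n) (v : 'I_n)
    (K : nat) : mem R :=
  (exec A LocalDensity (ld_input R v K)).1.

Definition ld_time (R : realType) (n : nat) (A : 'M[R]_n) (v : 'I_n)
    (K : nat) : nat :=
  (exec A LocalDensity (ld_input R v K)).2.

(* The list l[0 .. len - 1] enumerates S without repetition. *)
Definition holds_set (R : realType) (n : nat) (m : mem R) (l len : var Int)
    (S : {set 'I_n}) : Prop :=
  exists N : nat,
    read m len (0, 0, 0) = N%:Z /\
    perm_eq [seq (read m l (k%:Z, 0, 0) : int) | k <- iota 0 N]
            [seq code u | u <- enum S].

Definition ld_correct (R : realType) (n : nat) (A : 'M[R]_n) (v : 'I_n)
    (K : nat) (m : mem R) : Prop :=
  [/\ forall (t : nat) (u : 'I_n), (t <= ld_tau R K)%N ->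
        read m LD.x (t%:Z, code u, 0) = ld_x A v K t 0 u,
      forall (t : nat) (i j : int), (t < ld_tau R K)%N ->
        ld_X A v K t i != finset.set0 -> ld_Y A v K t j != finset.set0 ->
        read m LD.d (t%:Z, i, j) = density A (ld_X A v K t i) (ld_Y A v K t j) &
      exists S T : {set 'I_n},
        [/\ ld_output A v K S T, holds_set m LD.out_S LD.out_nS S
          & holds_set m LD.out_T LD.out_nT T]].

(* Main.v *)
(* An entry of x_t that survives the pruning contributes more than
   eps_t^2 ||y||^2 to the squared norm of y = round(x_{t-1} A), so x_t has at most
   eps_t^-2 = 64 K^2 / 4^t nonzero entries.  The iteration t costs
   O(Delta |supp x_t| + 1), since x_t A has at most Delta |supp x_t| nonzero
   entries and at most as many edges leave supp x_t; summing the geometric series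
   gives O(Delta K^2).

   For the correctness, a pair (X^t_i, Y^t_j) that spans no edge has density 0.
   Every vertex of Y^t_j has a neighbour in the support of x_t, so if there is any
   candidate pair then there is one of positive density, and it is enough to
   search among the pairs that span an edge. *)

Require Import Defs.
From mathcomp Require Import all_boot all_order all_algebra.
From mathcomp Require Import boolp classical_sets reals exp.
From mathcomp Require Import zify ring.
(* Several names, such as [mem] and [Real], are shadowed by MathComp. *)
Require Import Defs.

Set Implicit Arguments.
Unset Strict Implicit.
Unset Printing Implicit Defensive.

Import Order.TTheory GRing.Theory Num.Theory.

Local Open Scope ring_scope.

(** * Symbolic execution *)

(** Every command terminates, so a single predicate [wp] on final memory and running time gives
    correctness and cost from the same symbolic execution. The obstacle is bookkeeping: about thirty
    arrays and scalars, of which each loop changes few. It is met at two scales: a syntactic frame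
    rule preserves every array that a command never assigns, and inside an assigned array
    [agree_off] preserves all rows but one.

    All working arrays carry the time as first index, so each iteration finds rows that are still
    zero and pays for no clearing. Since weights and entries are positive, partial sums of x_t A
    never cancel: an accumulator is 0 exactly when its vertex has not been met yet. This is how the
    program lists supports without scanning V.

    The constant overhead of each iteration adds up to O(τ), which τ ≤ 2K absorbs. The bound uses
    max(1, Δ) because a vertex of the support costs constant time even if it has no neighbour. *)

Fixpoint imods (c : cmd) : seq nat :=
  match c with
  | Skip => [::]
  | Assign s x _ _ _ _ =>
      let: Var a := x in match s with Int => [:: a] | Real => [::] end
  | Seq c1 c2 | IfLt _ _ c1 c2 | IfEq _ _ c1 c2 => imods c1 ++ imods c2
  | For x _ c1 => let: Var a := x in a :: imods c1
  end.

Fixpoint rmods (c : cmd) : seq nat :=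
  match c with
  | Skip => [::]
  | Assign s x _ _ _ _ =>
      let: Var a := x in match s with Int => [::] | Real => [:: a] end
  | Seq c1 c2 | IfLt _ _ c1 c2 | IfEq _ _ c1 c2 => rmods c1 ++ rmods c2
  | For _ _ c1 => rmods c1
  end.

Definition frame (R : realType) (c : cmd) (m m' : mem R) : Prop :=
  (forall b, b \notin imods c -> imem m' b = imem m b) /\
  (forall b, b \notin rmods c -> rmem m' b = rmem m b).

(** One-array form of [upd]: for concrete array numbers, reading back after a write is convertible
    to it, so facts about a single array apply directly to memories. *)
Definition update (T : Type) (f : key -> T) (k : key) (w : T) : key -> T :=
  fun l => if l == k then w else f l.

Lemma upd_neq (T : Type) (f : nat -> key -> T) a k w b :
  b != a -> upd f a k w b = f b.
Proof. by move=> /negbTE ba; apply/funext => l; rewrite /upd ba. Qed.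

Definition location s (x : var s) : nat := let: Var a := x in a.

Lemma frame_int (R : realType) c (m m' : Defs.mem R) (x : var Int) :
  frame c m m' -> location x \notin imods c -> read m' x = read m x.
Proof. by case: x => a [Fi _] /Fi /= E; apply/funext => k /=; rewrite E. Qed.

Lemma frame_real (R : realType) c (m m' : Defs.mem R) (x : var Real) :
  frame c m m' -> location x \notin rmods c -> read m' x = read m x.
Proof. by case: x => a [_ Fr] /Fr /= E; apply/funext => k /=; rewrite E. Qed.

Section Semantics.
Variables (R : realType) (n : nat) (A : 'M[R]_n).
Implicit Types (m : mem R) (c : cmd).

Lemma frame_exec c m : frame c m (exec A c m).1.
Proof.
elim: c m => /=.
- by move=> m; split.
- by move=> [] [a] i j k e m; split=> b /=; rewrite ?inE => // ba; rewrite upd_neq.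
- move=> c1 IH1 c2 IH2 m; have [I1 R1] := IH1 m.
  case: (exec A c1 m) I1 R1 => m1 t1 /= I1 R1; have [I2 R2] := IH2 m1.
  case: (exec A c2 m1) I2 R2 => m2 t2 /= I2 R2.
  by split=> b; rewrite mem_cat negb_or => /andP[b1 b2]; rewrite ?I2 ?I1 ?R2 ?R1.
- move=> a b c1 IH1 c2 IH2 m.
  have [I1 R1] := IH1 m; have [I2 R2] := IH2 m.
  case: ifP => _; [case: (exec A c1 m) I1 R1 | case: (exec A c2 m) I2 R2];
  move=> m1 t1 /= Hi Hr; split=> b'; rewrite mem_cat negb_or => /andP[b1 b2];
  by rewrite ?Hi ?Hr.
- move=> a b c1 IH1 c2 IH2 m.
  have [I1 R1] := IH1 m; have [I2 R2] := IH2 m.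
  case: ifP => _; [case: (exec A c1 m) I1 R1 | case: (exec A c2 m) I2 R2];
  move=> m1 t1 /= Hi Hr; split=> b'; rewrite mem_cat negb_or => /andP[b1 b2];
  by rewrite ?Hi ?Hr.
- move=> [x] e c1 IH m; set N := (X in iota 0 X); set t0 := _.+1.
  (* The fold is generalised to any list of counter values and any initial time, since the tail of
     [iota 0 N] does not start at 0. *)
  move: (iota 0 N) t0 => {N}s t0; elim: s m t0 => [|l s IHs] m t0 //=.
  have [I1 R1] := IH (Mem (upd (imem m) x (0, 0, 0) l%:Z) (rmem m)).
  case: (exec A c1 _) I1 R1 => m1 t1 /= I1 R1.
  have [I2 R2] := IHs m1 (t0 + t1).+1.
  split=> b Hb.
    by rewrite I2 // I1 ?upd_neq //; move: Hb; rewrite inE negb_or => /andP[].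
  by rewrite R2 // R1.
Qed.

(** Execution is total and deterministic, so evaluating [Q] at its result is already the weakest
    precondition for total correctness; the second argument of [Q] is the time. *)
Definition wp c m (Q : mem R -> nat -> Prop) : Prop :=
  Q (exec A c m).1 (exec A c m).2.

(** The frame comes for free in the consequence, so the specification of a phase only has to mention
    the arrays that it changes. *)
Lemma wp_mono c m (P Q : mem R -> nat -> Prop) :
  wp c m P -> (forall m' t, frame c m m' -> P m' t -> Q m' t) -> wp c m Q.
Proof. by move=> H PQ; apply: PQ => //; apply: frame_exec. Qed.

Lemma wp_seq c1 c2 m Q :
  wp (Seq c1 c2) m Q =
  wp c1 m (fun m1 t1 => wp c2 m1 (fun m2 t2 => Q m2 (t1 + t2).+1)).
Proof. by rewrite /wp /=; case: (exec A c1 m) => m1 t1; case: (exec A c2 m1). Qed.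

Lemma wp_store s (x : var s) ks e m Q :
  wp (store x ks e) m Q =
  Q (write m x (eval A m (nth (Cst 0) ks 0), eval A m (nth (Cst 0) ks 1),
                eval A m (nth (Cst 0) ks 2)) (eval A m e))
    (exec A (store x ks e) m).2.
Proof. by []. Qed.

Lemma wp_skip m Q : wp Skip m Q = Q m 1%N.
Proof. by []. Qed.

Lemma wp_iflt a b c1 c2 m Q :
  wp (IfLt a b c1 c2) m Q =
  if (eval A m a : R) < eval A m b
  then wp c1 m (fun m' t => Q m' (cost a + cost b + t).+1)
  else wp c2 m (fun m' t => Q m' (cost a + cost b + t).+1).
Proof. by rewrite /wp /=; case: ifP => _; case: (exec A _ m). Qed.

Lemma wp_ifeq a b c1 c2 m Q :
  wp (IfEq a b c1 c2) m Q =
  if (eval A m a : R) == eval A m b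
  then wp c1 m (fun m' t => Q m' (cost a + cost b + t).+1)
  else wp c2 m (fun m' t => Q m' (cost a + cost b + t).+1).
Proof. by rewrite /wp /=; case: ifP => _; case: (exec A _ m). Qed.

(** The cost [k l] may depend on the round: the main loop needs the sum of the support sizes, not τ
    times their maximum. The frame of the whole loop is at hand in each round, so [I] need not
    repeat what the body leaves alone. *)
Lemma wp_for (x : var Int) (e : term Int) c m (N : nat)
    (I : nat -> Defs.mem R -> Prop)
    (k : nat -> nat) :
  eval A m e = N%:Z -> I 0%N m ->
  (forall l m', (l < N)%N -> frame (For x e c) m m' -> I l m' ->
     wp c (write m' x (0, 0, 0) l%:Z)
       (fun m'' t => I l.+1 m'' /\ (t <= k l)%N)) ->
  wp (For x e c) m
    (fun m' t => I N m' /\ (t <= cost e + 1 + \sum_(l < N) (k l).+1)%N).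
Proof.
move=> eN I0 step; rewrite /wp.
suff main j t0 : (j <= N)%N ->
    let r := foldl (fun (st : Defs.mem R * nat) (l : nat) =>
               let: (m', t) := exec A c (write st.1 x (0, 0, 0) l%:Z) in
               (m', (st.2 + t).+1)) (m, t0) (iota 0 j) in
    [/\ frame (For x e c) m r.1, I j r.1
      & (r.2 <= t0 + \sum_(l < j) (k l).+1)%N].
  rewrite [exec _ _ _]/= eN; have [//|_ H1 H2] := main N (cost e).+1.
  by split=> //; rewrite addn1.
elim: j => [|j IH] jN; first by split=> //=; rewrite big_ord0 addn0.
rewrite -addn1 iotaD foldl_cat /= add0n.
have [] := IH (ltnW jN); case: (foldl _ _ _) => m1 t1 /= F1 I1 T1.
have F2 := frame_exec c (write m1 x (0, 0, 0) j%:Z).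
have [] := step _ _ jN F1 I1.
move: F2; case: x F1 {step IH} => x [Fi Fr]; rewrite /= in Fi Fr *.
case: (exec A c _) => m2 t2 /= [Gi Gr] I2 T2; split.
- split=> b Hb.
    by rewrite Gi /= ?upd_neq ?Fi //; move: Hb; rewrite inE negb_or => /andP[].
  by rewrite Gr //= Fr.
- by rewrite addn1.
- by rewrite addn1 big_ord_recr /=; lia.
Qed.

Lemma wp_for_const (x : var Int) (e : term Int) c m (N : nat)
    (I : nat -> Defs.mem R -> Prop) (k : nat) :
  eval A m e = N%:Z -> I 0%N m ->
  (forall l m', (l < N)%N -> frame (For x e c) m m' -> I l m' ->
     wp c (write m' x (0, 0, 0) l%:Z)
       (fun m'' t => I l.+1 m'' /\ (t <= k)%N)) ->
  wp (For x e c) m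
    (fun m' t => I N m' /\ (t <= cost e + 1 + N * k.+1)%N).
Proof.
move=> eN I0 step; apply: wp_mono (wp_for (k := fun=> k) eN I0 step) _.
by move=> m' t _; rewrite sum_nat_const card_ord.
Qed.

Lemma adj_code (u : 'I_n) :
  adj A (code u) = [seq (code w, A u w) | w <- enum (nbrs A u)].
Proof. by rewrite /adj /code /decode /= valK. Qed.

Lemma code_inj : injective (@code n).
Proof. by move=> u w [] /val_inj. Qed.

Lemma code_eq (u w : 'I_n) : (code u == code w) = (u == w).
Proof. exact: (inj_eq code_inj). Qed.

End Semantics.

(** * Lists of vertices stored in arrays *)

Lemma take_rcons (T : Type) (s : seq T) l :
  (l < size s)%N -> exists x0, take l.+1 s = rcons (take l s) (nth x0 s l).
Proof. by case: s => // x0 s ls; exists x0; rewrite -take_nth. Qed.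

(* [s] is stored in the array [L] at the keys [f 0, f 1, ...], and its length
   in the cell [k] of [N]. *)
Definition listed (n : nat) (L N : key -> int) (f : int -> key) (k : key)
    (s : seq 'I_n) : Prop :=
  N k = (size s)%:Z /\
  mkseq (fun b => L (f b%:Z)) (size s) = [seq code u | u <- s].

Section Lists.
Variable n : nat.
Implicit Types (L N : key -> int) (f : int -> key) (s : seq 'I_n) (k : key).

Lemma listed_nth L N f k s u0 b :
  listed L N f k s -> (b < size s)%N -> L (f b%:Z) = code (nth u0 s b).
Proof.
move=> [_ H] bs; rewrite -(nth_mkseq (0:int) (fun b => L (f b%:Z)) bs) H.
by rewrite (nth_map u0).
Qed.

Lemma listed0 L N f k : N k = 0 -> listed L N f k ([::] : seq 'I_n).
Proof. by []. Qed.

(** Injectivity of [f] keeps the write at the end of the list from hitting an earlier entry. *)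
Lemma listed_push L N f k s u : injective f ->
  listed L N f k s ->
  listed (update L (f (N k)) (code u)) (update N k (N k + 1)) f k (rcons s u).
Proof.
move=> fI [Nk Hs]; split; first by rewrite /update eqxx Nk size_rcons; lia.
rewrite size_rcons map_rcons -Hs /mkseq -addn1 iotaD map_cat /= cats1 add0n.
rewrite {2}/update Nk eqxx; congr rcons; apply/eq_in_map => b.
rewrite mem_iota add0n => /andP[_ bs]; rewrite /update.
by case: eqP => // /fI [] E; rewrite E ltnn in bs.
Qed.

Lemma listed_push_other L N f k f' k' s x y z : 
  (forall b, f b != f' z) -> k != k' ->
  listed L N f k s ->
  listed (update L (f' z) x) (update N k' y) f k s.
Proof.
move=> ff /negbTE kk [Nk Hs]; split; first by rewrite /update kk.
by rewrite -Hs; apply: eq_map => b; rewrite /update (negbTE (ff _)).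
Qed.

Lemma listed_eq L N f k s L' N' : 
  (forall b, L' (f b) = L (f b)) -> N' k = N k ->
  listed L N f k s -> listed L' N' f k s.
Proof. by move=> HL HN [Nk Hs]; split; rewrite ?HN // -Hs; apply: eq_map => b. Qed.

End Lists.

(** * The pruned growth process *)

Section Rounding.
Variable R : realType.

(** The defining property of the ceiling, transported by the increasing logarithm. It shows that the
    set in [up_exp] has a least element when [r] is positive. *)
Lemma le_exp2 (r : R) (i : int) :
  0 < r -> (r <= 2 ^ i) = (Num.ceil (log2 r) <= i).
Proof.
move=> r0; have ln2 : 0 < ln (2 : R) by rewrite ln_gt0 // ltr1n.
rewrite ceil_le_int /log2 ler_pdivrMr // -ln_powR powR_intmul //.
by rewrite ler_ln // posrE ?exprz_gt0.
Qed.

Lemma up_expE (r : R) : 0 < r -> up_exp r = Num.ceil (log2 r).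
Proof.
move=> r0; apply: xget_unique.
  by split=> [|j]; rewrite le_exp2.
move=> i [ri imin]; apply/eqP; rewrite eq_le imin ?le_exp2 //=.
by rewrite -le_exp2.
Qed.

Lemma up_exp_exp2 (i : int) : up_exp (2 ^ i : R) = i.
Proof.
have p (j : int) : 0 < 2 ^ j :> R by rewrite exprz_gt0.
apply/eqP; rewrite up_expE // eq_le -le_exp2 // lexx /=.
by rewrite -(ler_eXz2l (x := 2 : R)) ?ltr1n // le_exp2.
Qed.

Lemma exp2_inj (i j : int) : 2 ^ i = 2 ^ j :> R -> i = j.
Proof. by move=> ij; rewrite -(up_exp_exp2 i) ij up_exp_exp2. Qed.

(** The program computes an integer, [ld_tau] an absolute value. They agree because sqrt(2K) ≥ 1: a
    negative ceiling would give sqrt(2K) ≤ 1/2. *)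
Lemma up_exp_tau K : (0 < K)%N ->
  up_exp (Num.sqrt (2 * K%:R) : R) = (ld_tau R K)%:Z.
Proof.
move=> K0; have K1 : 1 <= 2 * K%:R :> R.
  by rewrite -natrM ler1n muln_gt0.
have s1 : 1 <= Num.sqrt (2 * K%:R : R) by rewrite -[leLHS]sqrtr1 ler_wsqrtr.
rewrite up_expE ?(lt_le_trans ltr01) // /ld_tau gez0_abs //.
rewrite leNgt; apply/negP => c0.
have : Num.ceil (log2 (Num.sqrt (2 * K%:R : R))) <= -1.
  by move: (Num.ceil _) c0 => c; lia.
rewrite -le_exp2 ?(lt_le_trans ltr01) // => /(le_trans s1).
by rewrite exprN1 leNgt invf_lt1 ?ltr1n.
Qed.

(** Crude, but enough to fit the overhead of all iterations into K². After squaring, the claim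
    follows from 2K ≤ 2^(4K). *)
Lemma ld_tau_le K : (0 < K)%N -> (ld_tau R K <= 2 * K)%N.
Proof.
move=> K0; rewrite -lez_nat -up_exp_tau //.
have K1 : 0 < 2 * K%:R :> R by rewrite mulr_gt0 ?ltr0n.
rewrite up_expE ?sqrtr_gt0 // -le_exp2 ?sqrtr_gt0 //.
rewrite -(ler_pXn2r (n := 2)) ?nnegrE ?sqrtr_ge0 ?exprz_ge0 //.
rewrite sqr_sqrtr ?(ltW K1) // -exprM -natrM -natrX ler_nat.
apply: (@leq_trans (2 ^ (2 * K))%N); first exact: ltnW (ltn_expl _ _).
by rewrite leq_exp2l // leq_pmulr.
Qed.

End Rounding.

Section Vectors.
Variables (R : realType) (n : nat).
Implicit Types (z : 'rV[R]_n) (u w : 'I_n).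

Definition support z : {set 'I_n} := [set u | z 0 u != 0].

Lemma inner_ge0 z : 0 <= inner z z.
Proof. by apply: sumr_ge0 => u _; rewrite -expr2 sqr_ge0. Qed.

Lemma card_support_prune (eps : R) z : 0 <= eps ->
  #|support (prune eps z)|%:R * eps ^+ 2 <= 1.
Proof.
move=> eps0.
have n2 : norm z ^+ 2 = inner z z by rewrite sqr_sqrtr // inner_ge0.
have n0 : 0 <= norm z by apply: sqrtr_ge0.
have supp u : u \in support (prune eps z) -> eps * norm z < z 0 u.
  by rewrite inE mxE ltNge; case: ifP => //; rewrite eqxx.
have H : #|support (prune eps z)|%:R * (eps * norm z) ^+ 2 <= norm z ^+ 2.
  rewrite n2 /inner mulr_natl -sumr_const.
  rewrite [leRHS](bigID (fun u => u \in support (prune eps z))) /=.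
  rewrite -[leLHS]addr0 lerD //; last first.
    by apply: sumr_ge0 => u _; rewrite -expr2 sqr_ge0.
  apply: ler_sum => u /supp H; rewrite -expr2.
  have en : 0 <= eps * norm z by rewrite mulr_ge0.
  by rewrite ler_pXn2r ?nnegrE ?(ltW H) //; apply: le_trans (ltW H).
(* A zero norm cannot be cancelled from [H]; but then nothing survives, since a surviving entry is
   positive and would make the norm positive. *)
have [z0|] := eqVneq (norm z) 0; last first.
  move=> nz; have np : 0 < norm z ^+ 2 by rewrite exprn_gt0 // lt0r nz.
  by rewrite -(ler_pM2r np) mul1r -mulrA -exprMn.
suff -> : support (prune eps z) = finset.set0 by rewrite cards0 mul0r.
apply/setP => u; rewrite [RHS]inE; apply/negbTE/negP => /supp.
rewrite z0 mulr0 => zu; have : inner z z = 0 by rewrite -n2 z0 expr0n.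
apply/eqP; rewrite gt_eqF // /inner (bigD1 u) //= ltr_pwDl ?mulr_gt0 //.
by apply: sumr_ge0 => w _; rewrite -expr2 sqr_ge0.
Qed.

Lemma roundE z w : round z 0 w = if z 0 w == 0 then 0 else 2 ^ up_exp (z 0 w).
Proof. by rewrite mxE. Qed.

Lemma pruneE eps z w :
  prune eps z 0 w = if z 0 w <= eps * norm z then 0 else z 0 w.
Proof. by rewrite mxE. Qed.

Lemma level_round z j w :
  (w \in level (round z) j) = (z 0 w != 0) && (up_exp (z 0 w) == j).
Proof.
rewrite inE mxE; have [_|_] /= := eqVneq (z 0 w) 0.
  by apply: lt_eqF; rewrite exprz_gt0.
by apply/eqP/eqP => [/exp2_inj|->].
Qed.

End Vectors.

Section Growth.
Variables (R : realType) (n : nat) (A : 'M[R]_n) (v : 'I_n) (K : nat).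
Hypothesis K_gt0 : (0 < K)%N.
Local Notation x := (ld_x A v K).

Lemma ld_xS t : x t.+1 = prune (ld_eps R K t.+1) (round (x t *m A)).
Proof. by []. Qed.

(** Rounding yields powers of 2, pruning only deletes, and x_0 has entries 0 and 2^0. Hence the
    exponent that the program computes by [UpExp] identifies the level set, as [ld_XE] records. *)
Lemma ld_xP t u : x t 0 u = 0 \/ x t 0 u = 2 ^ up_exp (x t 0 u).
Proof.
suff [->|[i ->]] : x t 0 u = 0 \/ exists i : int, x t 0 u = 2 ^ i.
- by left.
- by right; rewrite up_exp_exp2.
case: t => [|t].
  by rewrite /= mxE; case: (u \in _); [right; exists 0; rewrite expr0z | left].
rewrite ld_xS mxE; case: ifP => _; first by left.
by rewrite mxE; case: ifP => _; [left | right; eexists].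
Qed.

Lemma ld_x_ge0 t u : 0 <= x t 0 u.
Proof. by case: (ld_xP t u) => ->; rewrite ?lexx // exprz_ge0. Qed.

Lemma ld_XE t i u :
  (u \in ld_X A v K t i) = (x t 0 u != 0) && (up_exp (x t 0 u) == i).
Proof.
rewrite inE; have := ld_xP t u; case: (x t 0 u =P 0) => [->|xn] [//|].
- by move=> _; apply: lt_eqF; rewrite exprz_gt0.
- by move=> _; apply: lt_eqF; rewrite exprz_gt0.
- by move=> /= E; rewrite E up_exp_exp2; apply/eqP/eqP => [/exp2_inj|->].
Qed.

Lemma card_support_x t : (#|support (x t)| * 4 ^ t <= 64 * K ^ 2)%N.
Proof.
(* x_0 is not the result of a pruning; its single vertex meets the bound because K > 0. *)
case: t => [|t].
  rewrite muln1; apply: (@leq_trans 1); last by rewrite muln_gt0 expn_gt0 K_gt0.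
  rewrite -(cards1 v) subset_leq_card //; apply/fintype.subsetP => u.
  by rewrite !inE mxE inE; case: (u == v); rewrite // eqxx.
rewrite ld_xS; set S := support _.
have := card_support_prune (round (x t *m A)) (_ : 0 <= ld_eps R K t.+1).
rewrite -/S => /(_ _)/wrap[].
  by rewrite divr_ge0 ?exprn_ge0 // mulr_ge0.
have K0 : 0 < K%:R :> R by rewrite ltr0n.
rewrite /ld_eps expr_div_n mulrA ler_pdivrMr ?exprn_gt0 ?mulr_gt0 //.
rewrite mul1r => H.
rewrite -(ler_nat R) !natrM !natrX.
have -> : 64 * K%:R ^+ 2 = (8 * K%:R) ^+ 2 :> R by ring.
have -> : 4 ^+ t.+1 = (2 ^+ t.+1) ^+ 2 :> R.
  by rewrite -exprM mulnC exprM; congr (_ ^+ _); ring.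
exact: H.
Qed.

Lemma sum_card_support T : (\sum_(t < T) #|support (x t)| <= 128 * K ^ 2)%N.
Proof.
(* A form without division of: the sum is at most 128 K² (1 - 2^-T). It uses only the bound 64 K² /
   2^t on each support, weaker than 64 K² / 4^t; the series of these bounds has limit 128 K². *)
suff : ((\sum_(t < T) #|support (x t)|) * 2 ^ T + 128 * K ^ 2 <=
        128 * K ^ 2 * 2 ^ T)%N.
  have : (0 < 2 ^ T)%N by rewrite expn_gt0.
  nia.
elim: T => [|T IH]; first by rewrite big_ord0 mul0n muln1.
rewrite big_ord_recr /= mulnDl.
have := card_support_x T; rewrite (expnMn 2 2 T : (4 ^ T = _)%N) => C.
have : (#|support (x T)| * 2 ^ T <= 64 * K ^ 2)%N.
  apply: leq_trans C; rewrite leq_mul2l; apply/orP; right.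
  by rewrite leq_pmulr // expn_gt0.
move: IH; rewrite (expnS 2 T).
move: (\sum_(_ < _) _)%N #|_| (2 ^ T)%N (K ^ 2)%N => S c P k.
by nia.
Qed.

End Growth.

(** * The phases of an iteration *)

Definition agree_off (V : Type) (t : int) (f g : key -> V) : Prop :=
  forall i j k, i != t -> f (i, j, k) = g (i, j, k).

Lemma agree_off_update (V : Type) (t : int) (f g : key -> V) a b w :
  agree_off t f g -> agree_off t (update f (t, a, b) w) g.
Proof.
by move=> fg i j k it; rewrite /update !xpair_eqE (negbTE it) /= fg.
Qed.

Lemma updE (T : Type) (f : nat -> key -> T) a k w b l :
  upd f a k w b l = if (b == a) && (l == k) then w else f b l.
Proof. by []. Qed.

(* In the symbolic execution, cells are designated by their numbers in the
   module [LD]: for instance, [imem m 18] is the array of [LD.t].  The facts [E]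
   are the values of the cells read by the program. *)
Ltac step E :=
  lazymatch goal with
  | |- wp _ (Seq _ _) _ _ => rewrite wp_seq
  | |- wp _ (store _ _ _) _ _ =>
      rewrite wp_store /= ?updE /=; rewrite ?eqxx /=; rewrite ?E
  | |- wp _ (LD.push _ _ _ _) _ _ => rewrite /LD.push
  end.
Ltac run E := repeat step E.

Lemma nth_notin_take (T : eqType) (x0 : T) (s : seq T) b :
  uniq s -> (b < size s)%N -> nth x0 s b \notin take b s.
Proof.
move=> us bs; move: us; rewrite -{1}(cat_take_drop b s) (drop_nth x0) //.
by rewrite cat_uniq /= negb_or => /and3P[_ /andP[]].
Qed.

Section Phases.
Variables (R : realType) (n : nat) (A : 'M[R]_n).
Implicit Types (m : Defs.mem R) (T : nat) (y : seq 'I_n).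

(** All classes share the arrays [L] and [N], separated by the middle index, so the push extends the
    list of class [g u] and leaves the others intact. *)
Lemma listed_push_class m (T : int) (L N : key -> int) (g : 'I_n -> int) s u :
  (forall i, listed L N (fun b => (T, i, b)) (T, i, 0) [seq w <- s | g w == i]) ->
  forall i, listed (update L (T, g u, N (T, g u, 0)) (code u))
                   (update N (T, g u, 0) (N (T, g u, 0) + 1))
              (fun b => (T, i, b)) (T, i, 0) [seq w <- rcons s u | g w == i].
Proof.
move=> H i; rewrite filter_rcons; have [<-|gi] := eqVneq (g u) i.
  by apply: (listed_push (f := fun b => (T, g u, b))) => // a b [].
apply: (listed_push_other (f' := fun b => (T, g u, b))) => //.
  by move=> b; rewrite !xpair_eqE eq_sym (negbTE gi) andbF.
by rewrite !xpair_eqE eq_sym (negbTE gi) andbF.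
Qed.

Lemma wp_rounding m T y (zf : 'I_n -> R) :
  read m LD.t (0, 0, 0) = T%:Z ->
  listed (read m LD.ys) (read m LD.yn) (fun b => (T%:Z, b, 0)) (T%:Z, 0, 0) y ->
  (forall w : 'I_n, read m LD.z (T%:Z, code w, 0) = zf w) ->
  (forall j, read m LD.Yn (T%:Z, j, 0) = 0) ->
  read m LD.ysq (T%:Z, 0, 0) = 0 ->
  wp A LD.rounding m (fun m' t =>
    [/\ forall j, listed (read m' LD.Ys) (read m' LD.Yn)
          (fun b => (T%:Z, j, b)) (T%:Z, j, 0) [seq w <- y | up_exp (zf w) == j],
        read m' LD.ysq (T%:Z, 0, 0) =
          \sum_(w <- y) 2 ^ up_exp (zf w) * 2 ^ up_exp (zf w),
        agree_off T (read m' LD.Ys) (read m LD.Ys),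
        agree_off T (read m' LD.Yn) (read m LD.Yn) &
        agree_off T (read m' LD.ysq) (read m LD.ysq)] /\
    (t <= 200 * (size y + 1))%N).
Proof.
rewrite /= => mT Ly mz mY mq.
have [yN _] := Ly.
pose I (l : nat) (m' : Defs.mem R) :=
  [/\ forall j, listed (read m' LD.Ys) (read m' LD.Yn)
          (fun b => (T%:Z, j, b)) (T%:Z, j, 0)
          [seq w <- take l y | up_exp (zf w) == j],
        read m' LD.ysq (T%:Z, 0, 0) =
          \sum_(w <- take l y) 2 ^ up_exp (zf w) * 2 ^ up_exp (zf w),
        agree_off T (read m' LD.Ys) (read m LD.Ys),
        agree_off T (read m' LD.Yn) (read m LD.Yn) &
        agree_off T (read m' LD.ysq) (read m LD.ysq)].
apply: wp_mono (wp_for_const (N := size y) (I := I) (k := 199) _ _ _) _.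
- by rewrite /= mT.
- by split=> [j||||//]; rewrite ?take0 ?big_nil //=; apply: listed0; exact: mY.
- move=> l m' ly [Fi Fr] [IY Iq OY OYn Oq].
  have [w0 yl] := take_rcons ly.
  set w := nth _ _ _ in yl.
  have Fy : imem m' 8 (T%:Z, l%:Z, 0) = code w by rewrite Fi //; exact: listed_nth Ly ly.
  have Ft : imem m' 18 (0, 0, 0) = T by rewrite Fi.
  have Fz : rmem m' 1 (T%:Z, code w, 0) = zf w by rewrite Fr.
  have E := (Ft, Fy, Fz).
  run E.
  split; last by [].
  split.
  - by rewrite yl; exact: listed_push_class IY.
  - by rewrite /= in Iq; rewrite yl big_rcons /= updE /= eqxx Iq.
  - exact: agree_off_update.
  - exact: agree_off_update.
  - exact: agree_off_update.
- move=> m' t _ [[IY Iq OY OYn Oq] ct]; rewrite take_size in IY Iq.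
  split; last by rewrite /= in ct; lia.
  by split.
Qed.

(** The strict test is the negation of the one in [prune]: the quotient is ε_{T+1}, and [q] stands
    for the squared norm of the rounded vector. *)
Definition survives (T K : nat) (q r : R) : bool :=
  2 ^ (T%:Z + 1) / (8 * K%:R) * Num.sqrt q < 2 ^ up_exp r.

Lemma wp_pruning m T K y (zf : 'I_n -> R) (q : R) :
  read m LD.t (0, 0, 0) = T%:Z ->
  read m LD.target (0, 0, 0) = K%:Z ->
  listed (read m LD.ys) (read m LD.yn) (fun b => (T%:Z, b, 0)) (T%:Z, 0, 0) y ->
  (forall w : 'I_n, read m LD.z (T%:Z, code w, 0) = zf w) ->
  read m LD.ysq (T%:Z, 0, 0) = q ->
  read m LD.xn (T%:Z + 1, 0, 0) = 0 ->
  (forall w : 'I_n, read m LD.x (T%:Z + 1, code w, 0) = 0) ->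
  wp A LD.pruning m (fun m' t =>
    [/\ listed (read m' LD.xs) (read m' LD.xn) (fun b => (T%:Z + 1, b, 0))
          (T%:Z + 1, 0, 0) [seq w <- y | survives T K q (zf w)],
        forall w : 'I_n, read m' LD.x (T%:Z + 1, code w, 0) =
          if (w \in y) && survives T K q (zf w) then 2 ^ up_exp (zf w) else 0,
        agree_off (T%:Z + 1) (read m' LD.xs) (read m LD.xs),
        agree_off (T%:Z + 1) (read m' LD.xn) (read m LD.xn) &
        agree_off (T%:Z + 1) (read m' LD.x) (read m LD.x)] /\
    (t <= 200 * (size y + 1))%N).
Proof.
rewrite /= => mT mK Ly mz mq mxn mx.
have [yN _] := Ly.
pose keep w := survives T K q (zf w).
pose I (l : nat) (m' : Defs.mem R) :=
  [/\ listed (read m' LD.xs) (read m' LD.xn) (fun b => (T%:Z + 1, b, 0))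
        (T%:Z + 1, 0, 0) [seq w <- take l y | keep w],
      forall w : 'I_n, read m' LD.x (T%:Z + 1, code w, 0) =
        if (w \in take l y) && keep w then 2 ^ up_exp (zf w) else 0,
      agree_off (T%:Z + 1) (read m' LD.xs) (read m LD.xs),
      agree_off (T%:Z + 1) (read m' LD.xn) (read m LD.xn) &
      agree_off (T%:Z + 1) (read m' LD.x) (read m LD.x)].
apply: wp_mono (wp_for_const (N := size y) (I := I) (k := 199) _ _ _) _.
- by rewrite /= mT.
- by split=> [|w|||//]; rewrite ?take0 ?in_nil ?mx //=; apply: listed0.
- move=> l m' ly [Fi Fr] [Ix Iv Oxs Oxn Ox].
  have [w0 yl] := take_rcons ly.
  set w := nth _ _ _ in yl.
  have Fy : imem m' 8 (T%:Z, l%:Z, 0) = code w.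
    by rewrite Fi //; exact: listed_nth Ly ly.
  have Ft : imem m' 18 (0, 0, 0) = T by rewrite Fi.
  have FK : imem m' 1 (0, 0, 0) = K by rewrite Fi.
  have Fz : rmem m' 1 (T%:Z, code w, 0) = zf w by rewrite Fr.
  have Fq : rmem m' 2 (T%:Z, 0, 0) = q by rewrite Fr.
  have E := (Ft, Fy, Fz, FK, Fq).
  run E; rewrite wp_iflt /= ?updE /= ?eqxx /= ?E -pmulrn -/(survives T K q (zf w)) -/(keep w).
  rewrite /= in Iv; case: ifP => kw.
  + run E; split; last by [].
    split.
    * rewrite yl filter_rcons kw.
      apply: (listed_push (f := fun b => (T%:Z + 1, b, 0))) Ix => a b [].
      exact: id.
    * move=> w'; rewrite /= updE /= !xpair_eqE eqxx code_eq andbT /= yl.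
      rewrite mem_rcons inE; have [->|_] := eqVneq w' w; first by rewrite kw.
      exact: Iv.
    * exact: agree_off_update.
    * exact: agree_off_update.
    * exact: agree_off_update.
  + rewrite wp_skip; split; last by [].
    split=> //; first by rewrite yl filter_rcons kw.
    move=> w'; rewrite /= yl mem_rcons inE Iv.
    by have [->|//] := eqVneq w' w; rewrite kw andbF.
- move=> m' t _ [[Ix Iv Oxs Oxn Ox] ct]; rewrite take_size in Ix Iv.
  split; last by rewrite /= in ct; lia.
  by split.
Qed.

(** The maximum with 1 lets the product with a number of vertices also pay for the constant cost of
    each vertex. *)
Definition degree_bound : nat := maxn 1 (max_degree A).

Lemma degree_bound_gt0 : (0 < degree_bound)%N.
Proof. by rewrite leq_max. Qed.

Lemma card_nbrs u : (#|nbrs A u| <= degree_bound)%N.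
Proof.
rewrite leq_max; apply/orP; right.
exact: (@leq_bigmax _ (fun u => #|nbrs A u|)).
Qed.

(** The vector [zf] is a parameter so that one predicate serves the loop over vertices, the loop
    over neighbours and the final result. *)
Definition spread_inv (T : nat) (zf : 'I_n -> R) m m' : Prop :=
  [/\ forall w : 'I_n, read m' LD.z (T%:Z, code w, 0) = zf w,
      exists y, [/\ listed (read m' LD.ys) (read m' LD.yn)
                      (fun b => (T%:Z, b, 0)) (T%:Z, 0, 0) y,
                    uniq y & forall w, (w \in y) = (zf w != 0)],
      agree_off T (read m' LD.z) (read m LD.z),
      agree_off T (read m' LD.ys) (read m LD.ys) &
      agree_off T (read m' LD.yn) (read m LD.yn)].

Lemma wp_spread m T s (X : 'I_n -> R) :
  (forall u w, 0 <= A u w) ->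
  read m LD.t (0, 0, 0) = T%:Z ->
  listed (read m LD.xs) (read m LD.xn) (fun b => (T%:Z, b, 0)) (T%:Z, 0, 0) s ->
  (forall u : 'I_n, read m LD.x (T%:Z, code u, 0) = X u) ->
  (forall u, u \in s -> 0 < X u) ->
  (forall w : 'I_n, read m LD.z (T%:Z, code w, 0) = 0) ->
  read m LD.yn (T%:Z, 0, 0) = 0 ->
  (forall i, read m LD.Xn (T%:Z, i, 0) = 0) ->
  wp A LD.spread m (fun m' t =>
    [/\ spread_inv T (fun w => \sum_(u <- s) X u * A u w) m m',
        forall i, listed (read m' LD.Xs) (read m' LD.Xn)
          (fun b => (T%:Z, i, b)) (T%:Z, i, 0) [seq u <- s | up_exp (X u) == i],
        agree_off T (read m' LD.Xs) (read m LD.Xs) &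
        agree_off T (read m' LD.Xn) (read m LD.Xn)] /\
    (t <= 1000 * (size s * degree_bound + 1))%N).
Proof.
rewrite /= => A0 mT Ls mx X0 mz myn mXn.
have [sN _] := Ls.
pose Z l w := \sum_(u <- take l s) X u * A u w.
have Z0 l w : 0 <= Z l w.
  rewrite /Z big_seq sumr_ge0 // => u /mem_take /X0 /ltW Xu.
  by rewrite mulr_ge0.
pose I (l : nat) (m' : Defs.mem R) :=
  [/\ spread_inv T (Z l) m m',
      forall i, listed (read m' LD.Xs) (read m' LD.Xn)
          (fun b => (T%:Z, i, b)) (T%:Z, i, 0)
          [seq u <- take l s | up_exp (X u) == i],
      agree_off T (read m' LD.Xs) (read m LD.Xs) &
      agree_off T (read m' LD.Xn) (read m LD.Xn)].
apply: wp_mono (wp_for_const (N := size s) (I := I)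
  (k := 300 * degree_bound + 300) _ _ _) _.
- by rewrite /= mT.
- split=> // [|i]; last by rewrite take0; apply: listed0; rewrite /= mXn.
  split=> // [w|]; first by rewrite /Z take0 big_nil /= mz.
  exists [::]; split=> // w.
  by rewrite /Z take0 big_nil eqxx.
- move=> l m' ls [Fi Fr] [[Iz [y [Ly Uy My]] Oz Oys Oyn] IX OX OXn].
  have [u0 sl] := take_rcons ls.
  have us : nth u0 s l \in s by rewrite mem_nth.
  have Fs : imem m' 6 (T%:Z, l%:Z, 0) = code (nth u0 s l).
    by rewrite Fi //; exact: listed_nth Ls ls.
  set u := nth _ _ _ in sl us Fs.
  have Xu := X0 _ us.
  have Ft : imem m' 18 (0, 0, 0) = T by rewrite Fi.
  have Fx : rmem m' 0 (T%:Z, code u, 0) = X u by rewrite Fr.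
  have E := (Ft, Fs, Fx).
  run E.
  set m1 := Mem _ _.
  set W := enum (nbrs A u).
  pose Zb b w := Z l w + (if w \in take b W then X u * A u w else 0).
  have ZbS b w : 0 <= Zb b w.
    by rewrite addr_ge0 //; case: ifP => // _; rewrite mulr_ge0 // ltW.
  (* A neighbour list has no repetition, so round [b] adds to one entry to which [u] has not yet
     contributed. *)
  have Sb b w' : (b < size W)%N -> Zb b.+1 w' =
      if w' == nth u W b then Zb b w' + X u * A u w' else Zb b w'.
    move=> bW; rewrite /Zb (take_nth u) // mem_rcons inE.
    have [->|//] := eqVneq w'; rewrite ifF ?addr0 //.
    by apply/negbTE; exact: nth_notin_take (enum_uniq _) bW.
  apply: wp_mono (wp_for_const (N := size W)
    (I := fun b => spread_inv T (Zb b) m) (k := 200) _ _ _) _.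
  + by rewrite /= updE /= adj_code size_map.
  + split=> // [w|]; first by rewrite /Zb take0 in_nil addr0; exact: Iz.
    by exists y; split=> // w; rewrite My /Zb take0 in_nil addr0.
  + move=> b m2 bW [Gi Gr] [Jz [y' [Jy Uy' My']] Jo Joy Joyn].
    set w := nth u W b in Sb.
    have Auw : 0 < A u w by have := mem_nth u bW; rewrite mem_enum inE.
    have En : nth (0, 0) (adj A (code u)) b = (code w, A u w).
      by rewrite adj_code (nth_map u).
    have Gt : imem m2 18 (0, 0, 0) = T by rewrite Gi.
    have Gu : imem m2 21 (0, 0, 0) = code u by rewrite Gi.
    have Gx : rmem m2 0 (T%:Z, code u, 0) = X u by rewrite Gr.
    rewrite /= in Jz; have Gz := Jz w.
    have E2 := (Gt, Gu, Gx, Gz, En).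
    run E2; rewrite wp_ifeq /= ?updE /= ?eqxx /= ?E2.
    (* Strict positivity makes the test against 0 a membership test: once met, a vertex never
       returns to 0, so it enters [ys] exactly once. *)
    have Pw : 0 < Zb b w + X u * A u w.
      by rewrite ltr_wpDl // mulr_gt0.
    case: ifP => zw.
    * run E2; split; last by [].
      split.
      - move=> w'; rewrite /= updE /= !xpair_eqE code_eq eqxx andbT /= Sb //.
        by have [->//|_] := eqVneq w' w; exact: Jz.
      - exists (rcons y' w); split.
        + by apply: (listed_push (f := fun b => (T%:Z, b, 0))) Jy => a' b' [].
        + by rewrite rcons_uniq Uy' My' zw.
        + move=> w'; rewrite mem_rcons inE My' Sb //.
          by have [->|] := eqVneq w' w; rewrite //= gt_eqF.
      - exact: agree_off_update.
      - exact: agree_off_update.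
      - exact: agree_off_update.
    * rewrite wp_skip; run E2; split; last by [].
      split=> //.
      - move=> w'; rewrite /= updE /= !xpair_eqE code_eq eqxx andbT /= Sb //.
        by have [->//|_] := eqVneq w' w; exact: Jz.
      - exists y'; split=> // w'; rewrite My' Sb //.
        by have [->|//] := eqVneq w' w; rewrite zw gt_eqF.
      - exact: agree_off_update.
  + move=> m2 t2 G [[Jz JY Jo Joy Joyn] ct2]; split.
    * split.
      (* After the last neighbour the restriction to [W] disappears, since a nonnegative weight that
         is not positive is 0. *)
      - suff -> : Z l.+1 = Zb (size W) by [].
        apply/funext => w; rewrite /Z sl big_rcons /Zb take_size mem_enum inE.
        case: ifPn => //; rewrite -leNgt => Aw.
        by rewrite (le_anti (x := A u w) (y := 0)) ?Aw ?A0 // mulr0.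
      - rewrite (frame_int (x := LD.Xs) G) // (frame_int (x := LD.Xn) G) // sl.
        exact: listed_push_class IX.
      - by rewrite (frame_int (x := LD.Xs) G) //; exact: agree_off_update.
      - by rewrite (frame_int (x := LD.Xn) G) //; exact: agree_off_update.
    * have := card_nbrs u; rewrite cardE -/W.
      rewrite /= in ct2 *; lia.
- move=> m' t _ [[Iz IX OX OXn] ct]; rewrite /I /Z take_size in Iz IX.
  split; first by split.
  have := leq_pmulr (size s) degree_bound_gt0.
  by rewrite /= in ct *; nia.
Qed.

End Phases.

(** * Traversal of the edges leaving the support *)

Section Edges.
Variables (R : realType) (n : nat) (A : 'M[R]_n).
Implicit Types (m : Defs.mem R) (T : nat) (y : seq 'I_n).

Definition edges (s : seq 'I_n) : seq ('I_n * 'I_n) :=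
  flatten [seq [seq (u, w) | w <- enum (nbrs A u)] | u <- s].

(** The variables [a], [b], [u], [w], [i], [j], which are numbered consecutively. *)
Definition scratch : seq nat := iota (location LD.a) 6.

(** Flattens the double loop into one pass over a list: [J P] describes the memory once the body has
    run on the pairs of [P]. The traversal itself writes only scratch cells, to which [J] must be
    insensitive. The body must preserve [u] and [i], set outside the inner loop; [w], [j] and the
    counters are rewritten before they are read again. *)
Lemma wp_for_edges m T (s : seq 'I_n) (X zf : 'I_n -> R) c (k : nat)
    (J : seq ('I_n * 'I_n) -> Defs.mem R -> Prop) :
  read m LD.t (0, 0, 0) = T%:Z ->
  listed (read m LD.xs) (read m LD.xn) (fun b => (T%:Z, b, 0)) (T%:Z, 0, 0) s ->
  (forall u : 'I_n, read m LD.x (T%:Z, code u, 0) = X u) ->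
  (forall w : 'I_n, read m LD.z (T%:Z, code w, 0) = zf w) ->
  all (fun b => b \notin imods c)
    [:: location LD.t; location LD.xs; location LD.xn; location LD.u;
        location LD.i] ->
  all (fun b => b \notin rmods c) [:: location LD.x; location LD.z] ->
  (forall P m1 m2, (forall b, b \notin scratch -> imem m2 b = imem m1 b) ->
     rmem m2 = rmem m1 -> J P m1 -> J P m2) ->
  (forall P m1 u w, u \in s -> 0 < A u w ->
     read m1 LD.t (0, 0, 0) = T%:Z ->
     read m1 LD.u (0, 0, 0) = code u -> read m1 LD.w (0, 0, 0) = code w ->
     read m1 LD.i (0, 0, 0) = up_exp (X u) ->
     read m1 LD.j (0, 0, 0) = up_exp (zf w) ->
     eval A m1 (Wt LD.u LD.b) = A u w ->
     J P m1 ->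
     wp A c m1 (fun m2 t => J (rcons P (u, w)) m2 /\ (t <= k)%N)) ->
  J [::] m ->
  wp A (LD.for_edges c) m (fun m' t =>
    J (edges s) m' /\ (t <= (k + 200) * (size s * degree_bound A + 1))%N).
Proof.
rewrite /= => mT Ls mx mz Hi Hr Jst Jstep J0.
have [sN _] := Ls.
case/and5P: Hi => c18 c6 c7 c21 /andP[c23 _].
case/and3P: Hr => c0 c1 _.
apply: wp_mono (wp_for_const (N := size s) (I := fun l => J (edges (take l s)))
  (k := (k + 50) * degree_bound A + 50) _ _ _) _.
- by rewrite /= mT.
- by rewrite take0.
- move=> l m' ls [Fi Fr] Jl.
  have [u0 sl] := take_rcons ls.
  have us : nth u0 s l \in s by rewrite mem_nth.
  have Fs : imem m' 6 (T%:Z, l%:Z, 0) = code (nth u0 s l).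
    by rewrite Fi ?inE //=; exact: listed_nth Ls ls.
  set u := nth _ _ _ in sl us Fs.
  have Ft : imem m' 18 (0, 0, 0) = T by rewrite Fi ?inE.
  have Fx : rmem m' 0 (T%:Z, code u, 0) = X u by rewrite Fr.
  have Fz (w : 'I_n) : rmem m' 1 (T%:Z, code w, 0) = zf w by rewrite Fr.
  have E := (Ft, Fs, Fx).
  run E.
  set m1 := Mem _ _.
  set W := enum (nbrs A u).
  apply: wp_mono (wp_for_const (N := size W)
    (I := fun b => J (edges (take l s) ++ [seq (u, w) | w <- take b W]))
    (k := k + 49) _ _ _) _.
  + by rewrite /= updE /= adj_code size_map.
  + rewrite take0 cats0; apply: Jst Jl => // b Hb.
    by rewrite /= !upd_neq //; apply: contraNneq Hb => ->.
  + move=> b m2 bW [Gi Gr] Jb.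
    set w := nth u W b.
    have Auw : 0 < A u w by have := mem_nth u bW; rewrite mem_enum inE.
    have En : nth (0, 0) (adj A (code u)) b = (code w, A u w).
      by rewrite adj_code (nth_map u).
    have Gt : imem m2 18 (0, 0, 0) = T by rewrite Gi ?inE.
    have Gu : imem m2 21 (0, 0, 0) = code u by rewrite Gi ?inE.
    have Gv : imem m2 23 (0, 0, 0) = up_exp (X u) by rewrite Gi ?inE.
    have Gz : rmem m2 1 (T%:Z, code w, 0) = zf w by rewrite Gr // Fz.
    have E2 := (Gt, Gu, Gv, Gz, En).
    run E2.
    apply: wp_mono (Jstep _ _ u w us Auw _ _ _ _ _ _ (Jst _ _ _ _ _ Jb)) _ => //.
    * by rewrite /= !updE /= Gu En.
    * by move=> b' Hb; rewrite /= !upd_neq //; apply: contraNneq Hb => ->.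
    * move=> m3 t3 _ [J3 ct3]; rewrite (take_nth u) // map_rcons -rcons_cat.
      by split=> //; lia.
  + move=> m2 t2 _ [J2 ct2]; split.
      by rewrite sl /edges map_rcons flatten_rcons; rewrite take_size in J2.
    have := card_nbrs A u; rewrite cardE -/W.
    by rewrite /= in ct2 *; nia.
- move=> m' t _ [J1 ct]; rewrite take_size in J1; split=> //.
  have := leq_pmulr (size s) (degree_bound_gt0 A).
  by rewrite /= in ct *; nia.
Qed.

End Edges.

(** * Densities and their running maximum *)

Section Densities.
Variables (R : realType) (n : nat) (A : 'M[R]_n).
Implicit Types (m : Defs.mem R) (T : nat) (y : seq 'I_n).

Definition edge_class (X zf : 'I_n -> R) (p : 'I_n * 'I_n) : int * int :=
  (up_exp (X p.1), up_exp (zf p.2)).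

(** [V] holds the triples compared so far. The recorded indices are meaningful only once [best] is
    positive; the value 0 stands for no pair found. *)
Definition best_inv (V : nat -> int -> int -> Prop) (D : nat -> int -> int -> R)
    m : Prop :=
  [/\ 0 <= read m LD.best (0, 0, 0),
      forall t i j, V t i j -> D t i j <= read m LD.best (0, 0, 0) &
      0 < read m LD.best (0, 0, 0) -> exists t i j,
        [/\ V t i j, read m LD.best (0, 0, 0) = D t i j,
            read m LD.best_t (0, 0, 0) = t%:Z,
            read m LD.best_i (0, 0, 0) = i & read m LD.best_j (0, 0, 0) = j]].

(** Two passes are made because a density needs the complete weight of its class. The second pass
    stores the same quotient once per edge of the class, which is harmless: it changes none of the
    arrays that the quotient is made of. *)
Lemma wp_densities m T (s : seq 'I_n) (X zf : 'I_n -> R)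
    (V : nat -> int -> int -> Prop) (D : nat -> int -> int -> R) :
  read m LD.t (0, 0, 0) = T%:Z ->
  listed (read m LD.xs) (read m LD.xn) (fun b => (T%:Z, b, 0)) (T%:Z, 0, 0) s ->
  (forall u : 'I_n, read m LD.x (T%:Z, code u, 0) = X u) ->
  (forall w : 'I_n, read m LD.z (T%:Z, code w, 0) = zf w) ->
  (forall i j, read m LD.e (T%:Z, i, j) = 0) ->
  (forall i j, read m LD.d (T%:Z, i, j) = 0) ->
  (forall i j,
    (\sum_(p <- edges A s | edge_class X zf p == (i, j)) A p.1 p.2) /
    (Num.sqrt (read m LD.Xn (T%:Z, i, 0) : int)%:~R *
     Num.sqrt (read m LD.Yn (T%:Z, j, 0) : int)%:~R) = D T i j) ->
  best_inv V D m ->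
  wp A LD.densities m (fun m' t =>
    [/\ forall i j, read m' LD.d (T%:Z, i, j) =
          if has (fun p => edge_class X zf p == (i, j)) (edges A s)
          then D T i j else 0,
        best_inv (fun t i j => V t i j \/ t = T /\
          has (fun p => edge_class X zf p == (i, j)) (edges A s)) D m',
        agree_off T (read m' LD.e) (read m LD.e) &
        agree_off T (read m' LD.d) (read m LD.d)] /\
    (t <= 1000 * (size s * degree_bound A + 1))%N).
Proof.
rewrite /= => mT Ls mx mz me md mD mbest.
rewrite /LD.densities wp_seq.
apply: wp_mono (wp_for_edges (k := 200) (J := fun P m' =>
  (forall i j, read m' LD.e (T%:Z, i, j) =
     \sum_(p <- P | edge_class X zf p == (i, j)) A p.1 p.2) /\
  agree_off T (read m' LD.e) (read m LD.e))
  mT Ls mx mz _ _ _ _ _) _; [by []|by []|..].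
- by move=> P m1 m2 _ Er [Je Jo]; split=> i j; rewrite /= Er //; [exact: Je|exact: Jo].
- move=> P m1 u w us Auw Ft Fu Fw Fi Fj FW [Je Jo].
  rewrite /= in Ft Fu Fw Fi Fj FW Je.
  have E := (Ft, Fu, Fw, Fi, Fj).
  rewrite wp_store /= E; split; last by [].
  split; last exact: agree_off_update.
  move=> i j; rewrite /= updE /= !xpair_eqE eqxx /= big_rcons /= Je.
  rewrite Fi Fj FW (eq_sym i) (eq_sym j) -xpair_eqE /edge_class /=.
  by case: eqP => [[<- <-]|_]; rewrite ?addr0 // Je.
- split=> // i j; rewrite big_nil; exact: me.
move=> m1 t1 G1 [[Je Jo] ct1].
have M1 x : location x \notin scratch ->
    read m1 (x : var Int) = read m x.
  move=> xs; apply: frame_int G1 _; apply: contra xs.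
  by move: (location x); apply/allP.
have R1 x : location x != 3%N -> read m1 (x : var Real) = read m x.
  by move=> xs; apply: frame_real G1 _; rewrite inE.
pose dens m' := forall i j, read m' LD.e (T%:Z, i, j) /
    (Num.sqrt (read m' LD.Xn (T%:Z, i, 0) : int)%:~R *
     Num.sqrt (read m' LD.Yn (T%:Z, j, 0) : int)%:~R) = D T i j.
pose visited (P : seq ('I_n * 'I_n)) t i j :=
  V t i j \/ t = T /\ has (fun p => edge_class X zf p == (i, j)) P.
pose J (P : seq ('I_n * 'I_n)) (m' : Defs.mem R) :=
  [/\ dens m',
      forall i j, read m' LD.d (T%:Z, i, j) =
        if has (fun p => edge_class X zf p == (i, j)) P then D T i j else 0,
      best_inv (visited P) D m', read m' LD.e = read m1 LD.e &
      agree_off T (read m' LD.d) (read m LD.d)].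
apply: wp_mono (wp_for_edges (k := 300) (J := J) (T := T) (s := s)
  (X := X) (zf := zf) _ _ _ _ _ _ _ _ _) _; try by [].
- by rewrite M1.
- by rewrite !M1.
- by rewrite R1.
- by rewrite R1.
- move=> P m2 m3 Ei Er [Jd Jv Jb Je' Jo'].
  have E a : location a \notin scratch -> read m3 (a : var Int) = read m2 a.
    by case: a => a /= /Ei Ea; apply/funext => l; rewrite /= Ea.
  have E' (a : var Real) : read m3 a = read m2 a.
    by case: a => a; apply/funext => l; rewrite /= Er.
  by split; rewrite /dens /best_inv ?E' // !E.
- move=> P m2 u w us Auw Ft Fu Fw Fi Fj FW [Jd Jv [b0 bV bex] Je' Jo'].
  have Jdij := Jd (up_exp (X u)) (up_exp (zf w)).
  rewrite /= in Ft Fu Fw Fi Fj FW Jdij.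
  have E := (Ft, Fu, Fw, Fi, Fj, Jdij).
  run E; rewrite wp_iflt /= !updE /= ?eqxx /= !E ?eqxx /=.
  have newd (i j : int) :
      update (read m2 LD.d) (T%:Z, up_exp (X u), up_exp (zf w))
        (D T (up_exp (X u)) (up_exp (zf w))) (T%:Z, i, j) =
      if has (fun p => edge_class X zf p == (i, j)) (rcons P (u, w))
      then D T i j else 0.
    rewrite /update !xpair_eqE eqxx /= has_rcons /edge_class /=.
    rewrite (eq_sym i) (eq_sym j) -xpair_eqE.
    by case: eqP => [[<- <-]//|_]; exact: Jv.
  have newV t i j : visited (rcons P (u, w)) t i j ->
      visited P t i j \/ [/\ t = T, i = up_exp (X u) & j = up_exp (zf w)].
    case=> [Vt|[-> ]]; first by left; left.
    rewrite has_rcons => /orP[/eqP[<- <-]|H]; first by right.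
    by left; right.
  have oldV t i j : visited P t i j -> visited (rcons P (u, w)) t i j.
    case=> [|[-> H]]; [by left|right; split=> //].
    by rewrite has_rcons H orbT.
  case: ltP => lt_best.
  + run E; split; last by [].
    split=> //; last exact: agree_off_update.
    split; rewrite /= ?updE ?eqxx /=.
    * exact: ltW (le_lt_trans b0 lt_best).
    * move=> t i j /newV[/bV tij|[-> -> ->]] //.
      exact: le_trans tij (ltW lt_best).
    * move=> _; exists T, (up_exp (X u)), (up_exp (zf w)); split=> //.
      by right; split=> //; rewrite has_rcons eqxx.
  + rewrite wp_skip; split; last by [].
    split=> //; last exact: agree_off_update.
    split=> //=.
    * by move=> t i j /newV[/bV tij|[-> -> ->]].
    * by move=> /bex[t [i [j [Vt ? ? ? ?]]]]; exists t, i, j; split=> //; exact: oldV.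
- case: mbest => b0 bV bex; split=> //.
  + by move=> i j; rewrite Je !M1 // mD.
  + by move=> i j; rewrite R1 //; exact: md.
  + split; rewrite ?R1 ?M1 //; first by move=> t i j [/bV//|[]].
    by move=> /bex[t [i [j [Vt ? ? ? ?]]]]; exists t, i, j; split=> //; left.
  + by rewrite R1.
move=> m2 t2 G2 [[_ Jv Jb Je' Jo2] ct2].
split; last by lia.
split=> //; first by rewrite Je'.
Qed.

End Densities.

(** * Candidate pairs *)

Lemma card_bigcup_le (I J : finType) (P : pred I) (F : I -> {set J}) :
  (#|\bigcup_(i | P i) F i| <= \sum_(i | P i) #|F i|)%N.
Proof.
elim/big_ind2: _ => [|a S b T Sa Tb|//]; first by rewrite cards0.
exact: leq_trans (leq_of_leqif (leq_card_setU S T)) (leq_add Sa Tb).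
Qed.

Section Pairs.
Variables (R : realType) (n : nat) (A : 'M[R]_n) (v : 'I_n) (K : nat).
Hypothesis A_ge0 : forall u w, 0 <= A u w.
Local Notation x := (ld_x A v K).
Local Notation X := (ld_X A v K).
Local Notation Y := (ld_Y A v K).

Lemma mulmx_row (z : 'rV[R]_n) w : (z *m A) 0 w = \sum_u z 0 u * A u w.
Proof. by rewrite mxE. Qed.

Lemma spread_gt0 t u w : x t 0 u != 0 -> 0 < A u w -> 0 < (x t *m A) 0 w.
Proof.
move=> xu Auw; rewrite mulmx_row (bigD1 u) //= ltr_pwDl //.
  by rewrite mulr_gt0 // lt0r xu ld_x_ge0.
by apply: sumr_ge0 => u' _; rewrite mulr_ge0 // ld_x_ge0.
Qed.

Lemma spread_neq0 t w : (x t *m A) 0 w != 0 ->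
  exists2 u, x t 0 u != 0 & 0 < A u w.
Proof.
apply: contraNP => H; rewrite mulmx_row big1 // => u _.
have [->|xu] := eqVneq (x t 0 u) 0; first by rewrite mul0r.
have [->|Au] := eqVneq (A u w) 0; first by rewrite mulr0.
by case: H; exists u; rewrite // lt0r Au A_ge0.
Qed.

Lemma card_support_spread t :
  (#|support (x t *m A)| <= #|support (x t)| * degree_bound A)%N.
Proof.
rewrite -sum_nat_const.
apply: leq_trans (_ : #|\bigcup_(u in support (x t)) nbrs A u| <= _)%N.
  apply/subset_leq_card/fintype.subsetP => w; rewrite inE => /spread_neq0[u xu Au].
  by apply/bigcupP; exists u; rewrite inE.
apply: leq_trans (card_bigcup_le _ _) (leq_sum _ _) => u _.
exact: card_nbrs.
Qed.

Lemma ld_YE t j w :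
  (w \in Y t j) = ((x t *m A) 0 w != 0) && (up_exp ((x t *m A) 0 w) == j).
Proof. exact: level_round. Qed.

(** The triples whose density the program actually computes, by [visitedP]. *)
Definition visited (t : nat) (i j : int) : Prop :=
  exists u w, [/\ u \in X t i, w \in Y t j & 0 < A u w].

Lemma edge_weightE (S T : {set 'I_n}) :
  edge_weight A S T = \sum_u \sum_w (if (u \in S) && (w \in T) then A u w else 0).
Proof.
rewrite /edge_weight /inner exchange_big /=; apply: eq_bigr => w _.
rewrite mulmx_row mulr_suml; apply: eq_bigr => u _; rewrite !mxE.
by case: (u \in S); case: (w \in T); rewrite ?mul1r ?mul0r ?mulr1 ?mulr0.
Qed.

Lemma edge_weight_ge0 S T : 0 <= edge_weight A S T.
Proof.
rewrite edge_weightE; apply: sumr_ge0 => u _; apply: sumr_ge0 => w _.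
by case: ifP.
Qed.

Lemma density_ge0 S T : 0 <= density A S T.
Proof. by rewrite divr_ge0 ?edge_weight_ge0 // mulr_ge0 ?sqrtr_ge0. Qed.

Lemma density_gt0 t i j : visited t i j -> 0 < density A (X t i) (Y t j).
Proof.
move=> [u [w [uX wY Auw]]].
have c0 (S : {set 'I_n}) a : a \in S -> 0 < Num.sqrt #|S|%:R :> R.
  by move=> aS; rewrite sqrtr_gt0 ltr0n card_gt0; apply/set0Pn; exists a.
rewrite divr_gt0 ?mulr_gt0 ?(c0 _ _ uX) ?(c0 _ _ wY) //.
rewrite edge_weightE (bigD1 u) //= ltr_pwDl //; last first.
  by apply: sumr_ge0 => u' _; apply: sumr_ge0 => w' _; case: ifP.
rewrite (bigD1 w) //= uX wY ltr_pwDl //.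
by apply: sumr_ge0 => w' _; case: ifP.
Qed.

Lemma density_unvisited t i j :
  ~ visited t i j -> density A (X t i) (Y t j) = 0.
Proof.
move=> nV; rewrite /density edge_weightE big1 ?mul0r // => u _.
rewrite big1 // => w _; case: ifP => // /andP[uX wY].
apply/eqP; rewrite eq_le A_ge0 andbT leNgt; apply/negP => Auw.
by apply: nV; exists u, w.
Qed.

Lemma visited_of_Y t j : Y t j != finset.set0 -> exists i, visited t i j.
Proof.
move=> /set0Pn[w wY]; move: (wY); rewrite ld_YE => /andP[/spread_neq0[u xu Au] _].
by exists (up_exp (x t 0 u)), u, w; split=> //; rewrite ld_XE xu eqxx.
Qed.

Lemma mem_edges s u w : ((u, w) \in edges A s) = (u \in s) && (0 < A u w).
Proof.
apply/flatten_mapP/andP => [[u' us /mapP[w' w'u [-> ->]]]|[us Auw]].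
  by move: w'u; rewrite mem_enum inE.
by exists u => //; apply: map_f; rewrite mem_enum inE.
Qed.

Section Listing.
Variables (t : nat) (s : seq 'I_n).
Hypotheses (s_uniq : uniq s) (s_supp : s =i support (x t)).
Local Notation class := (edge_class (fun u => x t 0 u) (fun w => (x t *m A) 0 w)).

(** On a listed edge both entries are nonzero, so exponents decide membership. At a zero entry
    [up_exp] would return its default 0 and suggest the level of 2^0. *)
Lemma edge_classE u w i j : (u, w) \in edges A s ->
  (class (u, w) == (i, j)) = (u \in X t i) && (w \in Y t j).
Proof.
rewrite mem_edges s_supp inE ld_XE ld_YE => /andP[xu Auw].
by rewrite xpair_eqE /= xu (gt_eqF (spread_gt0 xu Auw)).
Qed.

Lemma visitedP i j :
  has (fun p => class p == (i, j)) (edges A s) <-> visited t i j.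
Proof.
split=> [/hasP[[u w] uw]|[u [w [uX wY Auw]]]].
  rewrite edge_classE // => /andP[uX wY]; exists u, w; split=> //.
  by move: uw; rewrite mem_edges => /andP[].
have uw : (u, w) \in edges A s.
  by rewrite mem_edges s_supp inE Auw andbT; move: uX; rewrite ld_XE => /andP[].
by apply/hasP; exists (u, w); rewrite // edge_classE // uX.
Qed.

(** Compared with the full double sum, the list omits vertices outside the support, which lie in no
    level, and pairs that are not edges, which have weight 0. *)
Lemma edge_weight_edges i j :
  \sum_(p <- edges A s | class p == (i, j)) A p.1 p.2 =
  edge_weight A (X t i) (Y t j).
Proof.
rewrite edge_weightE big_flatten big_map /=.
rewrite [RHS](bigID (fun u => u \in s)) /= [X in _ = _ + X]big1 ?addr0; last first.
  move=> u us; rewrite big1 // => w _.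
  by rewrite ld_XE; move: us; rewrite s_supp inE => /negbNE ->.
rewrite -big_uniq //=; apply: eq_big_seq => u us.
rewrite big_map /= [RHS](bigID (fun w => w \in nbrs A u)) /=.
rewrite [X in _ = _ + X]big1 ?addr0; last first.
  move=> w; rewrite inE -leNgt => Aw; case: ifP => // _.
  by apply/eqP; rewrite eq_le Aw A_ge0.
rewrite -big_mkcondr /= -big_enum_cond /=.
rewrite [LHS]big_seq_cond [RHS]big_seq_cond; apply: eq_bigl => w.
rewrite mem_enum; case: (boolP (w \in nbrs A u)) => //=.
by rewrite inE => Auw; rewrite edge_classE // mem_edges us.
Qed.

Lemma filter_X i : [seq u <- s | up_exp (x t 0 u) == i] =i X t i.
Proof. by move=> u; rewrite mem_filter s_supp inE ld_XE andbC. Qed.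

Lemma spread_sum w : \sum_(u <- s) x t 0 u * A u w = (x t *m A) 0 w.
Proof.
rewrite big_uniq //= mulmx_row [RHS](bigID (fun u => u \in s)) /=.
rewrite [X in _ = _ + X]big1 ?addr0 // => u.
by rewrite s_supp inE => /negbNE/eqP ->; rewrite mul0r.
Qed.

End Listing.

Section Step.
Variables (t : nat) (y : seq 'I_n).
Local Notation z := (x t *m A).
Hypotheses (y_uniq : uniq y) (y_supp : y =i support z).
Local Notation q := (\sum_(w <- y) 2 ^ up_exp (z 0 w) * 2 ^ up_exp (z 0 w)).

Lemma inner_round : inner (round z) (round z) = q.
Proof.
rewrite big_uniq //= /inner [LHS](bigID (fun u => u \in y)) /=.
rewrite [X in _ + X = _]big1 ?addr0 => [|w]; last first.
  by rewrite y_supp inE roundE => /negbNE ->; rewrite mul0r.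
by apply: eq_bigr => w; rewrite y_supp inE roundE => /negbTE ->.
Qed.

(** Restates a growth step in the terms of the pruning loop, with the norm taken from the listed
    sum. A vertex outside [y] has rounded entry 0, which stays 0 on either side of the test. *)
Lemma ld_x_step w : x t.+1 0 w =
  if (w \in y) && survives t K q (z 0 w) then 2 ^ up_exp (z 0 w) else 0.
Proof.
rewrite ld_xS pruneE roundE y_supp inE -inner_round /survives /ld_eps.
have -> : t%:Z + 1 = t.+1%:Z by lia.
rewrite -exprnP -/(norm _); have [_|_] /= := eqVneq (z 0 w) 0.
  by case: ifP.
by rewrite leNgt; case: (_ < _).
Qed.

End Step.
End Pairs.

(** * The main loop *)

Section Run.
Variables (R : realType) (n : nat) (A : 'M[R]_n) (v : 'I_n) (K : nat).
Hypothesis A_ge0 : forall u w, 0 <= A u w.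
Hypothesis K_gt0 : (0 < K)%N.
Local Notation x := (ld_x A v K).
Local Notation X := (ld_X A v K).
Local Notation Y := (ld_Y A v K).
Local Notation D := (fun t i j => density A (X t i) (Y t j)).
Implicit Types m : Defs.mem R.

(** The algorithm is specified by sets while the program builds lists in its own traversal order, so
    the order is hidden by the existential. *)
Definition enumerates (L N : key -> int) (f : int -> key) (k : key)
    (S : {set 'I_n}) : Prop :=
  exists s, [/\ listed L N f k s, uniq s & s =i S].

(** The zero rows ahead replace the initialisation of iteration [T]. The lists of all past levels
    are retained because the output may be any of these pairs; of the supports, only the current one
    is still to be traversed. *)
Record invariant (T : nat) m : Prop := Invariant {
  inv_target : read m LD.target (0, 0, 0) = K%:Z;
  inv_x : forall (t : nat) (u : 'I_n), read m LD.x (t%:Z, code u, 0) =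
    if (t <= T)%N then x t 0 u else 0;
  inv_xs : enumerates (read m LD.xs) (read m LD.xn)
    (fun b => (T%:Z, b, 0)) (T%:Z, 0, 0) (support (x T));
  inv_xn : forall t, (T < t)%N -> read m LD.xn (t%:Z, 0, 0) = 0;
  inv_fresh : forall (t : nat) (i j : int), (T <= t)%N ->
    [/\ read m LD.z (t%:Z, i, j) = 0, read m LD.ysq (t%:Z, i, j) = 0 &
        read m LD.yn (t%:Z, i, j) = 0] /\
    [/\ read m LD.Xn (t%:Z, i, j) = 0, read m LD.Yn (t%:Z, i, j) = 0,
        read m LD.e (t%:Z, i, j) = 0 & read m LD.d (t%:Z, i, j) = 0];
  inv_Xs : forall t i, (t < T)%N -> enumerates (read m LD.Xs) (read m LD.Xn)
    (fun b => (t%:Z, i, b)) (t%:Z, i, 0) (X t i);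
  inv_Ys : forall t j, (t < T)%N -> enumerates (read m LD.Ys) (read m LD.Yn)
    (fun b => (t%:Z, j, b)) (t%:Z, j, 0) (Y t j);
  inv_d : forall t i j, (t < T)%N -> read m LD.d (t%:Z, i, j) = D t i j;
  inv_best : best_inv (fun t i j => (t < T)%N /\ visited A v K t i j) D m
}.

Definition body : cmd :=
  (LD.spread ;; LD.rounding ;; LD.pruning ;; LD.densities)%P.

Lemma size_enumerates (s : seq 'I_n) (S : {set 'I_n}) :
  uniq s -> s =i S -> size s = #|S|.
Proof. by move=> us sS; rewrite -(eq_card sS) (card_uniqP us). Qed.

(** Needed because [For] overwrites its counter between the end of one round and the body of the
    next. *)
Lemma invariant_write_t T m k w :
  invariant T m -> invariant T (write m LD.t k w).
Proof.
move=> H; set m' := write _ _ _ _.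
have Hi (y : var Int) : location y != location LD.t -> read m' y = read m y.
  by case: y => a a18; apply/funext => l; rewrite /m' /= upd_neq.
have Hr (y : var Real) : read m' y = read m y by case: y.
case: H => [mK mx mxs mxn mfresh mXs mYs md mbest]; split.
- by rewrite Hi.
- by move=> t u; rewrite Hr; exact: mx.
- by rewrite !Hi.
- by move=> t Tt; rewrite Hi //; exact: mxn.
- by move=> t i j Tt; rewrite !Hi // !Hr; exact: mfresh.
- by move=> t i tT; rewrite !Hi //; exact: mXs.
- by move=> t j tT; rewrite !Hi //; exact: mYs.
- by move=> t i j tT; rewrite Hr; exact: md.
- by rewrite /best_inv !Hr !Hi.
Qed.

Lemma agree_off_nat (V : Type) (T t : nat) (f g : key -> V) i j :
  agree_off T f g -> t != T -> f (t%:Z, i, j) = g (t%:Z, i, j).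
Proof. by move=> fg tT; apply: fg. Qed.

Lemma wp_body T m : invariant T m -> read m LD.t (0, 0, 0) = T%:Z ->
  wp A body m (fun m' t => invariant T.+1 m' /\
    (t <= 2500 * (#|support (x T)| * degree_bound A + 1))%N).
Proof.
move=> [mK mx [s [Ls us sS]] mxn mfresh mXs mYs md mbest] mT.
have T1 : T.+1%:Z = T%:Z + 1 by lia.
have Tx u : read m LD.x (T%:Z, code u, 0) = x T 0 u by rewrite mx leqnn.
have fresh i j := mfresh T i j (leqnn T).
pose zf w := (x T *m A) 0 w.
rewrite /body wp_seq.
apply: wp_mono (wp_spread (m := m) (T := T) (s := s) (X := fun u => x T 0 u)
  A_ge0 _ Ls Tx _ _ _ _) _ => //.
- by move=> u; rewrite sS inE lt0r ld_x_ge0 andbT.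
- by move=> w; have [[] ] := fresh (code w) 0.
- by have [[] ] := fresh 0 0.
- by move=> i; have [_ []] := fresh i 0.
move=> m1 t1 G1 [[[m1z [y [Ly uy yz]] o1z o1ys o1yn] m1Xs o1Xs o1Xn] ct1].
rewrite wp_seq.
have m1zf w : read m1 LD.z (T%:Z, code w, 0) = zf w.
  by rewrite m1z spread_sum.
apply: wp_mono (@wp_rounding R n A m1 T y zf _ _ _ _ _) _.
- by rewrite (frame_int G1).
- exact: Ly.
- exact: m1zf.
- by move=> j; rewrite (frame_int G1) //; have [_ []] := fresh j 0.
- by rewrite (frame_real G1) //; have [[] ] := fresh 0 0.
move=> m2 t2 G2 [[m2Ys m2q o2Ys o2Yn o2q] ct2].
rewrite wp_seq.
apply: wp_mono (@wp_pruning R n A m2 T K y zf _ _ _ _ _ m2q _ _) _.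
- by rewrite (frame_int G2) // (frame_int G1).
- by rewrite (frame_int G2) // (frame_int G1).
- by rewrite !(frame_int G2).
- by move=> w; rewrite (frame_real G2).
- by rewrite (frame_int G2) // (frame_int G1) // -T1; apply: mxn.
- move=> w; rewrite (frame_real G2) // (frame_real G1) // -T1.
  by have := mx T.+1 w; rewrite ltnn.
move=> m3 t3 G3 [[m3xs m3x o3xs o3xn o3x] ct3].
have yS : y =i support (x T *m A) by move=> w; rewrite yz inE spread_sum.
have Xlist i : listed (read m3 LD.Xs) (read m3 LD.Xn)
    (fun b => (T%:Z, i, b)) (T%:Z, i, 0) [seq u <- s | up_exp (x T 0 u) == i].
  by rewrite !(frame_int G3) // !(frame_int G2).
have Ylist j : listed (read m3 LD.Ys) (read m3 LD.Yn)
    (fun b => (T%:Z, j, b)) (T%:Z, j, 0) [seq w <- y | up_exp (zf w) == j].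
  by rewrite !(frame_int G3).
have Xmem i : [seq u <- s | up_exp (x T 0 u) == i] =i X T i.
  exact: filter_X.
have Ymem j : [seq w <- y | up_exp (zf w) == j] =i Y T j.
  by move=> w; rewrite mem_filter yS inE ld_YE andbC.
have TT1 : T != T.+1 by lia.
rewrite -T1 in o3x o3xs o3xn.
apply: wp_mono (@wp_densities R n A m3 T s (fun u => x T 0 u) zf
  (fun t i j => (t < T)%N /\ visited A v K t i j) D _ _ _ _ _ _ _ _) _.
- by rewrite (frame_int G3) // (frame_int G2) // (frame_int G1).
- apply: listed_eq Ls => [b|].
    by rewrite (agree_off_nat _ _ o3xs) // (frame_int G2) // (frame_int G1).
  by rewrite (agree_off_nat _ _ o3xn) // (frame_int G2) // (frame_int G1).
- by move=> u; rewrite (agree_off_nat _ _ o3x) // (frame_real G2) // (frame_real G1) //; exact: Tx.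
- by move=> w; rewrite (frame_real G3) // (frame_real G2).
- move=> i j; rewrite (frame_real G3) // (frame_real G2) // (frame_real G1) //.
  by have [_ []] := fresh i j.
- move=> i j; rewrite (frame_real G3) // (frame_real G2) // (frame_real G1) //.
  by have [_ []] := fresh i j.
- move=> i j; rewrite edge_weight_edges // (Xlist i).1 (Ylist j).1.
  by rewrite (size_enumerates _ (Xmem i)) ?(size_enumerates _ (Ymem j)) ?filter_uniq.
- have [b0 bV bex] := mbest.
  have Rb : read m3 LD.best = read m LD.best.
    by rewrite (frame_real G3) // (frame_real G2) // (frame_real G1).
  have Rt : read m3 LD.best_t = read m LD.best_t.
    by rewrite (frame_int G3) // (frame_int G2) // (frame_int G1).
  have Ri : read m3 LD.best_i = read m LD.best_i.
    by rewrite (frame_int G3) // (frame_int G2) // (frame_int G1).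
  have Rj : read m3 LD.best_j = read m LD.best_j.
    by rewrite (frame_int G3) // (frame_int G2) // (frame_int G1).
  by rewrite /best_inv Rb Rt Ri Rj.
move=> m4 t4 G4 [[m4d m4best o4e o4d] ct4].
have vis i j := visitedP A_ge0 sS i j.
split; last first.
  (* With s = |supp x_T| and d the degree bound, spreading and densities cost 1000 (s d + 1) each,
     rounding and pruning 200 (s d + 1) each by [c1]; 2500 also covers the sequencing. *)
  have c1 := card_support_spread v K A_ge0 T.
  rewrite (size_enumerates us sS) in ct1 ct4.
  rewrite (size_enumerates uy yS) in ct2 ct3.
  lia.
split.
- by rewrite (frame_int G4) // (frame_int G3) // (frame_int G2) // (frame_int G1).
- move=> t u; rewrite (frame_real G4) //.
  have [->|tT] := eqVneq t T.+1; first by rewrite T1 m3x leqnn (ld_x_step uy yS).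
  rewrite (agree_off_nat _ _ o3x) // (frame_real G2) // (frame_real G1) //.
  have -> : (t <= T.+1)%N = (t <= T)%N by lia.
  exact: mx.
- exists [seq w <- y | survives T K
    (\sum_(w0 <- y) 2 ^ up_exp (zf w0) * 2 ^ up_exp (zf w0)) (zf w)].
  rewrite T1 !(frame_int G4) // filter_uniq //; split=> // w.
  rewrite mem_filter inE (ld_x_step uy yS) andbC.
  by case: ifP; rewrite ?eqxx // gt_eqF // exprz_gt0.
- move=> t tT; rewrite (frame_int G4) // (agree_off_nat _ _ o3xn) //; last by lia.
  by rewrite (frame_int G2) // (frame_int G1) //; apply: mxn; lia.
- move=> t i j tT; have tT' : t != T by lia.
  have [[f1 f2 f3] [f4 f5 f6 f7]] := mfresh t i j (ltnW tT).
  split; split.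
  + by rewrite (frame_real G4) // (frame_real G3) // (frame_real G2) // (agree_off_nat _ _ o1z).
  + by rewrite (frame_real G4) // (frame_real G3) // (agree_off_nat _ _ o2q) // (frame_real G1).
  + by rewrite (frame_int G4) // (frame_int G3) // (frame_int G2) // (agree_off_nat _ _ o1yn).
  + by rewrite (frame_int G4) // (frame_int G3) // (frame_int G2) // (agree_off_nat _ _ o1Xn).
  + by rewrite (frame_int G4) // (frame_int G3) // (agree_off_nat _ _ o2Yn) // (frame_int G1).
  + by rewrite (agree_off_nat _ _ o4e) // (frame_real G3) // (frame_real G2) // (frame_real G1).
  + by rewrite (agree_off_nat _ _ o4d) // (frame_real G3) // (frame_real G2) // (frame_real G1).
- move=> t i tT; rewrite !(frame_int G4) //.
  have [->|tT'] := eqVneq t T.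
    by eexists; split; [exact: Xlist|exact: filter_uniq|exact: Xmem].
  have [|s' [Ls' us' sS']] := mXs t i; first by lia.
  exists s'; split=> //; rewrite !(frame_int G3) // !(frame_int G2) //.
  by apply: listed_eq Ls' => [b|];
    rewrite ?(agree_off_nat _ _ o1Xs) ?(agree_off_nat _ _ o1Xn).
- move=> t j tT; rewrite !(frame_int G4) //.
  have [->|tT'] := eqVneq t T.
    by eexists; split; [exact: Ylist|exact: filter_uniq|exact: Ymem].
  have [|s' [Ls' us' sS']] := mYs t j; first by lia.
  exists s'; split=> //; rewrite !(frame_int G3) //.
  apply: listed_eq Ls' => [b|].
    by rewrite (agree_off_nat _ _ o2Ys) // (frame_int G1).
  by rewrite (agree_off_nat _ _ o2Yn) // (frame_int G1).
- move=> t i j tT; have [->|tT'] := eqVneq t T.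
    rewrite m4d; case: ifPn => // /negP nV; rewrite density_unvisited //.
    by move=> /vis.
  rewrite (agree_off_nat _ _ o4d) // (frame_real G3) // (frame_real G2) // (frame_real G1) //.
  by apply: md; lia.
- have [b0 bV bex] := m4best; split=> //.
  + move=> t i j [tT Vt]; apply: bV; have [tT'|tT'] := eqVneq t T.
      by right; split=> //; apply/vis; rewrite -tT'.
    by left; split=> //; lia.
  + move=> /bex[t [i [j [Vt ? ? ? ?]]]]; exists t, i, j; split=> //.
    case: Vt => [[tT Vt]|[-> /vis Vt]]; split=> //; lia.
Qed.

End Run.

(** * Copying a pair of stored lists to the output *)

Section Output.
Variables (R : realType) (n : nat) (A : 'M[R]_n).
Implicit Types m : Defs.mem R.

Lemma wp_copy_S m (t : nat) (i : int) (s : seq 'I_n) :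
  read m LD.best_t (0, 0, 0) = t%:Z -> read m LD.best_i (0, 0, 0) = i ->
  listed (read m LD.Xs) (read m LD.Xn) (fun b => (t%:Z, i, b)) (t%:Z, i, 0) s ->
  read m LD.out_nS (0, 0, 0) = 0 ->
  wp A (For LD.a (LD.Xn [:: LD.best_t; LD.best_i]%P)
         (LD.push LD.out_S LD.out_nS [::] (LD.Xs [:: LD.best_t; LD.best_i; LD.a]%P))) m
    (fun m' k =>
      listed (read m' LD.out_S) (read m' LD.out_nS) (fun b => (b, 0, 0)) (0, 0, 0) s /\
      (k <= 100 * (size s + 1))%N).
Proof.
move=> mt mi Ls ml.
pose I (l : nat) (m' : Defs.mem R) := listed (read m' LD.out_S) (read m' LD.out_nS)
  (fun b => (b, 0, 0)) (0, 0, 0) (take l s).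
apply: wp_mono (wp_for_const (N := size s) (I := I) (k := 90) _ _ _) _.
- by rewrite /= in mt mi *; rewrite mt mi; exact: Ls.1.
- by rewrite /I take0; apply: listed0.
- move=> l m' ls [Fi _] Il.
  have [u0 sl] := take_rcons ls.
  have Fs : imem m' 10 (t%:Z, i, l%:Z) = code (nth u0 s l).
    by rewrite Fi //; exact: listed_nth Ls ls.
  have Ft : imem m' 14 (0, 0, 0) = t by rewrite Fi.
  have Fx : imem m' 15 (0, 0, 0) = i by rewrite Fi.
  have E := (Ft, Fx, Fs).
  run E; split; last by [].
  rewrite /I sl; apply: (listed_push (f := fun b => (b, 0, 0))) Il => a b [].
  exact: id.
- move=> m' k _ [Il ck]; rewrite /I take_size in Il; split=> //.
  by rewrite /= in ck; lia.
Qed.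

Lemma wp_copy_T m (t : nat) (i : int) (s : seq 'I_n) :
  read m LD.best_t (0, 0, 0) = t%:Z -> read m LD.best_j (0, 0, 0) = i ->
  listed (read m LD.Ys) (read m LD.Yn) (fun b => (t%:Z, i, b)) (t%:Z, i, 0) s ->
  read m LD.out_nT (0, 0, 0) = 0 ->
  wp A (For LD.a (LD.Yn [:: LD.best_t; LD.best_j]%P)
         (LD.push LD.out_T LD.out_nT [::] (LD.Ys [:: LD.best_t; LD.best_j; LD.a]%P))) m
    (fun m' k =>
      listed (read m' LD.out_T) (read m' LD.out_nT) (fun b => (b, 0, 0)) (0, 0, 0) s /\
      (k <= 100 * (size s + 1))%N).
Proof.
move=> mt mi Ls ml.
pose I (l : nat) (m' : Defs.mem R) := listed (read m' LD.out_T) (read m' LD.out_nT)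
  (fun b => (b, 0, 0)) (0, 0, 0) (take l s).
apply: wp_mono (wp_for_const (N := size s) (I := I) (k := 90) _ _ _) _.
- by rewrite /= in mt mi *; rewrite mt mi; exact: Ls.1.
- by rewrite /I take0; apply: listed0.
- move=> l m' ls [Fi _] Il.
  have [u0 sl] := take_rcons ls.
  have Fs : imem m' 12 (t%:Z, i, l%:Z) = code (nth u0 s l).
    by rewrite Fi //; exact: listed_nth Ls ls.
  have Ft : imem m' 14 (0, 0, 0) = t by rewrite Fi.
  have Fx : imem m' 16 (0, 0, 0) = i by rewrite Fi.
  have E := (Ft, Fx, Fs).
  run E; split; last by [].
  rewrite /I sl; apply: (listed_push (f := fun b => (b, 0, 0))) Il => a b [].
  exact: id.
- move=> m' k _ [Il ck]; rewrite /I take_size in Il; split=> //.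
  by rewrite /= in ck; lia.
Qed.

Lemma holds_set_listed m (l len : var Int) (s : seq 'I_n) (S : {set 'I_n}) :
  listed (read m l) (read m len) (fun b => (b, 0, 0)) (0, 0, 0) s ->
  uniq s -> s =i S -> holds_set m l len S.
Proof.
move=> [sN sl] us sS; exists (size s); split=> //.
rewrite -[X in perm_eq X _]/(mkseq (fun k => read m l (k%:Z, 0, 0)) (size s)).
rewrite [mkseq _ _]sl perm_map // uniq_perm ?enum_uniq // => u.
by rewrite sS mem_enum.
Qed.

End Output.

(** * Initialisation, output and total running time *)

Section Final.
Variables (R : realType) (n : nat) (A : 'M[R]_n) (v : 'I_n) (K : nat).
Hypothesis A_ge0 : forall u w, 0 <= A u w.
Hypothesis K_gt0 : (0 < K)%N.
Implicit Types m : Defs.mem R.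
Local Notation x := (ld_x A v K).
Local Notation X := (ld_X A v K).
Local Notation Y := (ld_Y A v K).
Local Notation tau := (ld_tau R K).

Lemma wp_start : wp A LD.start (ld_input R v K) (fun m t =>
  [/\ invariant A v K 0 m, read m LD.tau (0, 0, 0) = tau%:Z,
      read m LD.out_nS (0, 0, 0) = 0, read m LD.out_nT (0, 0, 0) = 0 &
      (t <= 100)%N]).
Proof.
rewrite /LD.start /ld_input.
have E : up_exp (Num.sqrt (2%:~R * K%:~R) : R) = tau%:Z.
  by rewrite -pmulrn up_exp_tau.
run E; split=> //; split=> //.
- move=> t u; rewrite /= updE /= !xpair_eqE code_eq andbT leqn0 eqz_nat.
  by case: eqP => [->|]; rewrite //= !mxE inE; case: (u == v).
- exists [:: v]; split=> // u.
  by rewrite !inE mxE inE; case: (u == v); rewrite ?oner_eq0 ?eqxx.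
- by case=> [|t].
- by split=> [||] /=; [|move=> t i j []|rewrite ltxx].
Qed.

Lemma wp_output m : invariant A v K tau m ->
  read m LD.out_nS (0, 0, 0) = 0 -> read m LD.out_nT (0, 0, 0) = 0 ->
  wp A LD.output m (fun m' k =>
    (exists S T : {set 'I_n}, [/\ ld_output A v K S T,
       holds_set m' LD.out_S LD.out_nS S & holds_set m' LD.out_T LD.out_nT T]) /\
    (k <= 1000 * (100 * (degree_bound A * K ^ 2)))%N).
Proof.
move=> [mK mx mxs mxn mfresh mXs mYs md [b0 bV bex]] mS mT.
(* A candidate may itself span no edge; what it guarantees is a visited pair with the same [Y] side,
   hence a positive density. *)
have candidateP S T : ld_candidate A v K S T -> exists (t : nat) (i j : int),
    [/\ (t < tau)%N, S = X t i, T = Y t j &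
      exists2 i', visited A v K t i' j & (t < tau)%N].
  move=> [t [i [j [tT -> -> _ Y0]]]]; exists t, i, j; split=> //.
  by have [i' Vt] := visited_of_Y A_ge0 Y0; exists i'.
rewrite /LD.output wp_iflt.
have -> : eval A m (LD.real 0) = 0 :> R by [].
have -> : eval A m LD.best = read m LD.best (0, 0, 0) by [].
case: ltP => [best_gt0|best_le0]; last first.
  rewrite wp_skip; split; last first.
    have : (0 < degree_bound A * K ^ 2)%N.
      by rewrite muln_gt0 degree_bound_gt0 expn_gt0 K_gt0.
    by move: (_ * _)%N => p; rewrite /=; lia.
  have empty (l len : var Int) : read m len (0, 0, 0) = 0 ->
      holds_set m l len (finset.set0 : {set 'I_n}).
    move=> len0; apply: (@holds_set_listed _ _ _ _ _ [::]) => // u.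
    by rewrite !inE.
  exists finset.set0, finset.set0; split; [|exact: empty|exact: empty].
  right; split=> // S T /candidateP[t [i [j [tT _ _ [i' Vt _]]]]].
  have := le_trans (bV t i' j (conj tT Vt)) best_le0.
  by apply/negP; rewrite -ltNge; apply: density_gt0.
have [t [i [j [[tT Vt] bD mt mi mj]]]] := bex best_gt0.
have [s [Ls us sX]] := mXs t i tT.
have [y [Ly uy yY]] := mYs t j tT.
rewrite wp_seq.
apply: wp_mono (@wp_copy_S R n A m t i s mt mi Ls mS) _ => m1 k1 G1 [LS ck1].
apply: wp_mono (@wp_copy_T R n A m1 t j y _ _ _ _) _.
- by rewrite (frame_int G1).
- by rewrite (frame_int G1).
- by rewrite !(frame_int G1).
- by rewrite (frame_int G1).
move=> m2 k2 G2 [LT ck2]; split; last first.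
  (* The copied sets lie in the supports of x_t and x_t A, so at most 64 K² (1 + d) vertices are
     copied, where d is the degree bound. *)
  have cX := subset_leq_card (_ : X t i \subset support (x t)).
  have cY := subset_leq_card (_ : Y t j \subset support (x t *m A)).
  have {}cX : (#|X t i| <= #|support (x t)|)%N.
    by apply: cX; apply/fintype.subsetP => u; rewrite ld_XE inE => /andP[].
  have {}cY : (#|Y t j| <= #|support (x t *m A)|)%N.
    by apply: cY; apply/fintype.subsetP => u; rewrite ld_YE inE => /andP[].
  rewrite (size_enumerates us sX) in ck1.
  rewrite (size_enumerates uy yY) in ck2.
  have c1 := card_support_spread v K A_ge0 t.
  have c2 : (#|support (x t)| <= 64 * K ^ 2)%N.
    by apply: leq_trans (card_support_x A v K_gt0 t); rewrite leq_pmulr // expn_gt0.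
  have D0 := degree_bound_gt0 A.
  have K0 : (0 < K ^ 2)%N by rewrite expn_gt0 K_gt0.
  have c3 := leq_mul c2 (leqnn (degree_bound A)).
  rewrite /=; move: ck1 ck2 c1 c2 cX cY c3 K0 D0; clear.
  move: #|X t i| #|Y t j| #|support (x t)| #|support (x t *m A)|.
  move: (K ^ 2)%N (degree_bound A) => *; nia.
exists (X t i), (Y t j); split.
- left; split.
    have [u [w [uX wY _]]] := Vt.
    by exists t, i, j; split=> //; apply/set0Pn; [exists u | exists w].
  move=> S T /candidateP[t' [i' [j' [tT' -> -> _]]]].
  (* A pair that was never compared with [best] has density 0 and cannot beat the output. *)
  have [V'|/(density_unvisited A_ge0) ->] := EM (visited A v K t' i' j').
    by rewrite -bD; apply: bV.
  exact: density_ge0.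
- by apply: holds_set_listed us sX; rewrite !(frame_int G2).
- exact: holds_set_listed LT uy yY.
Qed.

Lemma wp_LocalDensity : wp A LocalDensity (ld_input R v K) (fun m t =>
  ld_correct A v K m /\ (t <= 1000 * (1000 * (degree_bound A * K ^ 2)))%N).
Proof.
rewrite /LocalDensity wp_seq.
apply: wp_mono wp_start _ => m0 t0 G0 [I0 m0tau m0S m0T ct0].
rewrite wp_seq.
apply: wp_mono (@wp_for R n A LD.t LD.tau _ m0 tau (invariant A v K)
  (fun T => 2500 * (#|support (x T)| * degree_bound A + 1))%N _ I0 _) _.
- by rewrite -m0tau.
- by move=> T m TT _ IT; apply: wp_body => //; exact: invariant_write_t.
move=> m1 t1 G1 [I1 ct1].
apply: wp_mono (wp_output I1 _ _) _.
- by rewrite (frame_int G1).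
- by rewrite (frame_int G1).
move=> m2 t2 G2 [out ct2]; split.
  split=> //.
  - move=> t u tT; rewrite (frame_real G2) //.
    by have := inv_x I1 t u; rewrite tT.
  - by move=> t i j tT _ _; rewrite (frame_real G2) //; exact: inv_d I1 _ _ _ tT.
(* With d the degree bound, the supports contribute 2500 · 128 d K², the overhead 2501 τ ≤ 5002 K,
   and the output at most 10^5 d K²; the sum stays below 10^6 d K². *)
have s1 := sum_card_support A v K_gt0 tau.
have s2 := ld_tau_le R K_gt0.
have s3 : (\sum_(T < tau) (2500 * (#|support (x T)| * degree_bound A + 1)).+1 <=
    2500 * ((\sum_(T < tau) #|support (x T)|) * degree_bound A) + 2501 * tau)%N.
  rewrite big_distrl /= big_distrr /= mulnC -[in X in (_ + X)%N](card_ord tau).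
  rewrite -sum_nat_const -big_split /=; apply: leq_sum => T _; lia.
have s4 := leq_mul s1 (leqnn (degree_bound A)).
have s5 : (K <= K ^ 2)%N := leq_pmulr K K_gt0.
have s6 := leq_pmulr (K ^ 2) (degree_bound_gt0 A).
have s7 : (0 < K ^ 2)%N by rewrite expn_gt0 K_gt0.
have {s3} ct1' := leq_trans ct1 (leq_add (leqnn _) s3).
rewrite /= in ct1' *.
move: ct0 ct1' ct2 s2 s4 s5 s6 s7; clear.
set S := (\sum_(_ < _) _)%N; move: S tau => S t'.
move: (K ^ 2)%N (degree_bound A) => k d; nia.
Qed.

End Final.

Theorem theorem2 (R : realType) :
  exists C : nat,
    forall (n : nat) (A : 'M[R]_n) (v : 'I_n) (K : nat),
      bipartite_graph A -> (0 < K)%N ->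
      ld_correct A v K (ld_final A v K) /\
      (ld_time A v K <= C * (maxn 1 (max_degree A) * K ^ 2))%N.
Proof.
exists (1000 * 1000)%N => n A v K [_ A_ge0 _] K_gt0.
have [correct time] : wp _ _ _ _ := wp_LocalDensity v A_ge0 K_gt0.
by split=> //; rewrite -mulnA.
Qed.
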